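(* Let $M$ be a Riemannian manifold modelled on a Hilbert space $H$, let $f:M\to(-\infty,\infty]$ be a function, let $p\in M$ with $f(p)<\infty$, and let $\eta\in T^{*}M_{p}$. The following statements are equivalent: (1) $\eta\in D^{-}f(p)$, that is, there exists a $C^1$ smooth function $\varphi:M\to\mathbb{R}$ so that $f-\varphi$ attains a local minimum at $p$, and $\eta=d\varphi(p)$. (2) There exists a function $\varphi:M\to\mathbb{R}$ so that $f-\varphi$ attains a local minimum at $p$, $\varphi$ is Fréchet differentiable at $p$, and $\eta=d\varphi(p)$. (3) For every chart $h:U\subset M\to H$ with $p\in U$, if we take $\zeta=\eta\circ dh^{-1}(h(p))$ then $$\liminf_{v\to 0}\frac{(f\circ h^{-1})(h(p)+v)-f(p)-\langle\zeta,v\rangle}{\|v\|}\geq 0.$$ (4) There exists a chart $h:U\subset M\to H$ with $p\in U$ such that, for $\zeta=\eta\circ dh^{-1}(h(p))$, $$\liminf_{v\to 0}\frac{(f\circ h^{-1})(h(p)+v)-f(p)-\langle\zeta,v\rangle}{\|v\|}\geq 0.$$ Moreover, if $f$ is locally bounded below (every $x\in M$ has a neighborhood on which $f$ is bounded below), then conditions (1), (2), (3) and (4) are also equivalent to: (5) There exists a $C^1$ smooth function $\varphi:M\to\mathbb{R}$ so that $f-\varphi$ attains a global minimum at $p$, and $\eta=d\varphi(p)$. Analogous statements are equivalent for superdifferentials: the following are equivalent: (1') $\eta\in D^{+}f(p)$, that is, there is a $C^1$ smooth $\varphi:M\to\mathbb{R}$ such that $f-\varphi$ attains a local maximum at $p$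 and $\eta=d\varphi(p)$; (2') there is a function $\varphi:M\to\mathbb{R}$, Fréchet differentiable at $p$, such that $f-\varphi$ attains a local maximum at $p$ and $\eta=d\varphi(p)$; (3') for every chart $h:U\subset M\to H$ with $p\in U$, with $\zeta=\eta\circ dh^{-1}(h(p))$, $$\limsup_{v\to 0}\frac{(f\circ h^{-1})(h(p)+v)-f(p)-\langle\zeta,v\rangle}{\|v\|}\leq 0;$$ (4') there exists a chart $h:U\subset M\to H$ with $p\in U$ for which the inequality in (3') holds with $\zeta=\eta\circ dh^{-1}(h(p))$. If moreover $f$ is locally bounded above, these are also equivalent to: (5') there is a $C^1$ smooth $\varphi:M\to\mathbb{R}$ such that $f-\varphi$ attains a global maximum at $p$ and $\eta=d\varphi(p)$.
   Context: A Riemannian manifold is a $C^\infty$ manifold modelled on a Hilbert space $H$ (possibly infinite-dimensional) with a $C^\infty$ assignment of scalar products on the tangent spaces $TM_p\simeq H$ whose norms are equivalent to that of $H$. Charts belong to the $C^\infty$ structure. For $f:M\to(-\infty,\infty]$ and $p$ with $f(p)<\infty$, $D^{-}f(p)$ (the subdifferential) is the set of all $d\varphi(p)\in T^*M_p$ with $\varphi\in C^1(M,\mathbb{R})$ such that $f-\varphi$ attains a local minimum at $p$; $D^{+}f(p)$ (the superdifferential) is the set of all $d\varphi(p)$ with $\varphi\in C^1(M,\mathbb{R})$ such that $f-\varphi$ attains a local maximum at $p$. Here $\langle\zeta,v\rangle=\zeta(v)$ for $\zeta\in H^*$, $v\in H$. *)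

(* Defs.v *)
From HB Require Import structures.
From mathcomp Require Import all_boot all_order all_algebra.
From mathcomp Require Import all_classical all_reals all_analysis.

Set Implicit Arguments.
Unset Strict Implicit.
Unset Printing Implicit Defensive.

Import Order.TTheory GRing.Theory Num.Theory.
Import numFieldNormedType.Exports.

Local Open Scope classical_set_scope.
Local Open Scope ring_scope.

HB.mixin Record CompleteNormedModule_isHilbert (R : realType) H
    & CompleteNormedModule R H := {
  hdot : H -> H -> R ;
  hdotC : forall u v, hdot u v = hdot v u ;
  hdotDl : forall u v w, hdot (u + v) w = hdot u w + hdot v w ;
  hdotZl : forall (a : R) u v, hdot (a *: u) v = a * hdot u v ;
  hdotE : forall u, hdot u u = `|u| ^+ 2
}.

#[short(type="hilbertType")]
HB.structure Definition Hilbert (R : realType) :=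
  {H of CompleteNormedModule R H & CompleteNormedModule_isHilbert R H}.

Section ContinuousLinear.
Context {R : realType} (V W : normedModType R).

Definition clin_pred : {pred V -> W} :=
  mem [set f : V -> W | linear f /\ continuous f].

Lemma clin_submod_closed : submod_closed clin_pred.
Proof.
split=> [|a f g].
  rewrite inE /=; split; last by move=> x; exact: cvg_cst.
  by move=> a u v /=; rewrite scaler0 addr0.
rewrite !inE /= => -[fl fc] [gl gc]; split.
  have E x : (a *: f + g) x = a *: f x + g x by [].
  by move=> b u v; rewrite !E fl gl !scalerDr !scalerA [b * a]mulrC addrACA.
by move=> x; have := cvgD (cvgZl_tmp (k := a) (fc x)) (gc x); apply.
Qed.

HB.instance Definition _ :=
  GRing.isSubmodClosed.Build R (V -> W) clin_pred clin_submod_closed.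

Record clin := CLin { clin_fun :> V -> W ; _ : clin_fun \in clin_pred }.

HB.instance Definition _ := [isSub for clin_fun].
HB.instance Definition _ := [Choice of clin by <:].
HB.instance Definition _ := [SubChoice_isSubLmodule of clin by <:].

Lemma clin_linear (f : clin) : linear f.
Proof. by case: f => f /=; rewrite inE => -[]. Qed.

Lemma clin_continuous (f : clin) : continuous f.
Proof. by case: f => f /=; rewrite inE => -[]. Qed.

HB.instance Definition _ (f : clin) :=
  GRing.isLinear.Build R V W *:%R (clin_fun f) (clin_linear f).

Implicit Types f : clin.

Definition clin_bounds f : set R :=
  [set C | 0 <= C /\ forall x, `|f x| <= C * `|x|].

Definition opnorm f : R := inf (clin_bounds f).

Lemma clin_bounds_has_inf f : has_inf (clin_bounds f).
Proof.
split; last by exists 0 => C [].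
have /linear_boundedP := continuous_linear_bounded 0 (@clin_continuous f 0).
by case/pinfty_ex_gt0 => C C0 fC; exists C; split; [exact: ltW|exact: fC].
Qed.

Lemma opnorm_ge0 f : 0 <= opnorm f.
Proof. by apply: lb_le_inf; [case: (clin_bounds_has_inf f)|move=> C []]. Qed.

Lemma opnormP f x : `|f x| <= opnorm f * `|x|.
Proof.
have [->|x0] := eqVneq x 0.
  by rewrite linear0 !normr0 mulr0.
rewrite -ler_pdivrMr ?normr_gt0//; apply: lb_le_inf.
  by case: (clin_bounds_has_inf f).
by move=> C [_ fC]; rewrite ler_pdivrMr ?normr_gt0.
Qed.

Lemma opnorm_le f C : 0 <= C -> (forall x, `|f x| <= C * `|x|) -> opnorm f <= C.
Proof.
by move=> C0 fC; apply: ge_inf; [case: (clin_bounds_has_inf f)|split].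
Qed.

End ContinuousLinear.

Section OperatorNorm.
Context {R : realType} (V W : normedModType R).
Implicit Types f g : clin V W.

Lemma opnormD f g : opnorm (f + g) <= opnorm f + opnorm g.
Proof.
apply: opnorm_le => [|x]; first by rewrite addr_ge0 ?opnorm_ge0.
rewrite mulrDl [X in `|X|](_ : _ = f x + g x)// (le_trans (ler_normD _ _))//.
by rewrite lerD ?opnormP.
Qed.

Lemma opnormZ_le (a : R) f : opnorm (a *: f) <= `|a| * opnorm f.
Proof.
apply: opnorm_le => [|x]; first by rewrite mulr_ge0 ?opnorm_ge0.
rewrite [X in `|X|](_ : _ = a *: f x)// normrZ -mulrA.
by rewrite ler_wpM2l ?opnormP.
Qed.

Lemma opnormZ (a : R) f : opnorm (a *: f) = `|a| * opnorm f.
Proof.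
apply/eqP; rewrite eq_le opnormZ_le/=.
have [->|a0] := eqVneq a 0; first by rewrite normr0 mul0r opnorm_ge0.
rewrite -ler_pdivlMl ?normr_gt0// -normfV.
by apply: le_trans (opnormZ_le _ _); rewrite scalerA mulVf// scale1r.
Qed.

Lemma opnorm_eq0 f : opnorm f = 0 -> f = 0.
Proof.
move=> f0; apply: val_inj; apply: funext => x /=.
by apply/eqP; rewrite -normr_eq0 eq_le normr_ge0 andbT (le_trans (opnormP f x))// f0 mul0r.
Qed.

HB.instance Definition _ :=
  Lmodule_isNormed.Build R (clin V W) opnormD opnormZ opnorm_eq0.

End OperatorNorm.

Section Smoothness.
Context {R : realType} {V : normedModType R}.

Fixpoint Ck_on (k : nat) : forall W : normedModType R, set V -> (V -> W) -> Prop :=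
  match k with
  | 0 => fun W D f => {in D, continuous f}
  | n.+1 => fun W D f => exists df : V -> clin V W,
      {in D, forall x, differentiable f x /\ 'd f x = df x :> (V -> W)} /\
      Ck_on n D df
  end.

Definition smooth_on (W : normedModType R) (D : set V) (f : V -> W) :=
  forall k, Ck_on k D f.

End Smoothness.

(* [chart_map] is only meaningful on [chart_dom], and its inverse [chart_inv]
   only on the image of [chart_dom]; both are total functions, with arbitrary
   values elsewhere. *)
Record chart (R : realType) (H : hilbertType R) (M : topologicalType) := Chart {
  chart_dom : set M ;
  chart_map :> M -> H ;
  chart_inv : H -> M ;
  chart_dom_open : open chart_dom ;
  chart_img_open : open (chart_map @` chart_dom) ;
  chart_mapK : {in chart_dom, cancel chart_map chart_inv} ;
  chart_map_continuous : {in chart_dom, continuous chart_map} ;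
  chart_inv_continuous : {in chart_map @` chart_dom, continuous chart_inv}
}.

Section Transition.
Context {R : realType} {H : hilbertType R} {M : topologicalType}.
Implicit Types h k : chart H M.

Definition chart_img h : set H := h @` chart_dom h.

Definition transition h k : H -> H := k \o chart_inv h.

Definition compatible h k :=
  smooth_on (h @` (chart_dom h `&` chart_dom k)) (transition h k) /\
  smooth_on (k @` (chart_dom h `&` chart_dom k)) (transition k h).

End Transition.

Record manifold (R : realType) (H : hilbertType R) := Manifold {
  manifold_sort :> topologicalType ;
  manifold_hausdorff : hausdorff_space manifold_sort ;
  atlas : set (chart H manifold_sort) ;
  atlas_cover : forall p, exists2 h, atlas h & chart_dom h p ;
  atlas_compatible : forall h k, atlas h -> atlas k -> compatible h k ;
  atlas_maximal : forall h, (forall k, atlas k -> compatible h k) -> atlas h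
}.

Record chart_at (R : realType) (H : hilbertType R) (M : manifold H) (p : M) :=
  ChartAt {
  chart_at_chart :> chart H M ;
  chart_at_atlas : atlas chart_at_chart ;
  chart_at_dom : chart_dom chart_at_chart p
}.

Section ChartLemmas.
Context {R : realType} {H : hilbertType R} (M : manifold H) (p : M).
Implicit Types h k l : chart_at p.

Lemma chart_at_ex : exists h : chart_at p, True.
Proof. by have [h hA hp] := atlas_cover p; exists (ChartAt hA hp). Qed.

Definition some_chart : chart_at p := projT1 (cid chart_at_ex).

Lemma chart_atK h : chart_inv h (h p) = p.
Proof. by rewrite chart_mapK// inE; exact: chart_at_dom. Qed.

Lemma near_chart_dom h : \forall x \near h p, chart_dom h (chart_inv h x).
Proof.
have : nbhs (h p) (h @` chart_dom h).
  apply: open_nbhs_nbhs; split; first exact: chart_img_open.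
  by exists p => //; exact: chart_at_dom.
by apply: filterS => _ [q hq <-]; rewrite chart_mapK ?inE.
Qed.

Lemma chart_inv_cvg h : chart_inv h x @[x --> h p] --> p.
Proof.
rewrite -[X in _ --> X](chart_atK h); apply: chart_inv_continuous.
by rewrite inE; exists p => //; exact: chart_at_dom.
Qed.

Lemma transition_differentiable h k : differentiable (transition h k) (h p).
Proof.
have [+ _] := atlas_compatible (chart_at_atlas h) (chart_at_atlas k).
move=> /(_ 1%N)[df [ddf _]].
have hp : h p \in h @` (chart_dom h `&` chart_dom k).
  by rewrite inE; exists p => //; split; exact: chart_at_dom.
by have [] := ddf _ hp.
Qed.

Lemma differentiable_near (V W : normedModType R) (f g : V -> W) (x : V) :
  (\forall y \near x, f y = g y) -> differentiable f x ->
  differentiable g x /\ 'd f x = 'd g x :> (V -> W).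
Proof.
move=> fg fx; have fgx : f x = g x by exact: nbhs_singleton fg.
have gE : g \o shift x = cst (g x) + 'd f x +o_ 0 id.
  apply/eqaddoP => e e0.
  have /eqaddoP/(_ e e0) := diff_locally fx.
  have : \forall y \near (0 : V), f (shift x y) = g (shift x y).
    by move: fg; rewrite [X in X -> _](near_shift 0) subr0.
  apply: filterS2 => y fgy; rewrite -fgx.
  by rewrite -[(g \o _ - _) y]/(g (shift x y) - _) -fgy.
have dgE := diff_unique (diff_continuous fx) gE.
by split; [apply/diff_locallyP; rewrite dgE; split => //; exact: diff_continuous|].
Qed.

Lemma diff_chart_change (W : normedModType R) (u : M -> W) h k :
  differentiable (u \o chart_inv k) (k p) ->
  differentiable (u \o chart_inv h) (h p) /\
  'd (u \o chart_inv h) (h p) =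
    'd (u \o chart_inv k) (k p) \o 'd (transition h k) (h p) :> (H -> W).
Proof.
have Ek : transition h k (h p) = k p by rewrite /transition/= chart_atK.
rewrite -Ek => du; have dt := transition_differentiable h k.
have near_eq : \forall x \near h p,
    ((u \o chart_inv k) \o transition h k) x = (u \o chart_inv h) x.
  have Dk : nbhs p (chart_dom k).
    by apply: open_nbhs_nbhs; split;
      [exact: chart_dom_open|exact: chart_at_dom].
  have : \forall x \near h p, chart_dom k (chart_inv h x).
    exact: (@chart_inv_cvg h _ Dk).
  by apply: filterS => x xk /=; rewrite chart_mapK ?inE.
have [? <-] := differentiable_near near_eq (differentiable_comp dt du).
by split=> //; rewrite diff_comp.
Qed.

Lemma diff_transition h k l v :
  'd (transition h l) (h p) v =
  'd (transition k l) (k p) ('d (transition h k) (h p) v).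
Proof.
by have [_ ->] := diff_chart_change h (transition_differentiable k l).
Qed.

Lemma diff_transition_id h v : 'd (transition h h) (h p) v = v.
Proof.
have near_eq : \forall x \near h p, x = transition h h x.
  have : nbhs (h p) (h @` chart_dom h).
    apply: open_nbhs_nbhs; split; first exact: chart_img_open.
    by exists p => //; exact: chart_at_dom.
  by apply: filterS => _ [q hq <-]; rewrite /transition/= chart_mapK ?inE.
have idh : is_diff (h p) (@id H) id by exact: is_diff_id.
have [_ <-] := differentiable_near near_eq (@ex_diff _ _ _ _ _ _ _ idh).
by rewrite diff_val.
Qed.

End ChartLemmas.

Section Tangent.
Context {R : realType} {H : hilbertType R} (M : manifold H) (p : M).

(* A tangent vector is given by its representatives in all the charts around
   [p], related to each other by the differentials of the transition maps. *)
Definition tangent_pred : {pred chart_at p -> H} :=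
  mem [set v : chart_at p -> H |
    forall h k : chart_at p, v k = 'd (transition h k) (h p) (v h)].

Lemma tangent_submod_closed : submod_closed tangent_pred.
Proof.
split=> [|a u v]; first by rewrite inE /= => h k; rewrite linear0.
rewrite !inE /= => uE vE h k.
have E l : (a *: u + v) l = a *: u l + v l by [].
by rewrite !E linearP -uE -vE.
Qed.

HB.instance Definition _ := GRing.isSubmodClosed.Build R (chart_at p -> H)
  tangent_pred tangent_submod_closed.

Record tangent := Tangent {
  tangent_coord : chart_at p -> H ;
  _ : tangent_coord \in tangent_pred
}.

HB.instance Definition _ := [isSub for tangent_coord].
HB.instance Definition _ := [Choice of tangent by <:].
HB.instance Definition _ := [SubChoice_isSubLmodule of tangent by <:].

(* [dchart h] is dh(p) and [dchart_inv h] is dh^{-1}(h(p)). *)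
Definition dchart (h : chart_at p) (v : tangent) : H := tangent_coord v h.

Lemma dchart_inv_subproof (h : chart_at p) (v : H) :
  (fun k : chart_at p => 'd (transition h k) (h p) v) \in tangent_pred.
Proof. by rewrite inE => k l /=; exact: diff_transition. Qed.

Definition dchart_inv (h : chart_at p) (v : H) : tangent :=
  Tangent (dchart_inv_subproof h v).

Lemma dchartK h : cancel (dchart h) (dchart_inv h).
Proof.
move=> v; apply: val_inj; apply: funext => k /=; rewrite /dchart.
by case: v => v /=; rewrite inE => vE; rewrite -vE.
Qed.

Lemma dchart_invK h : cancel (dchart_inv h) (dchart h).
Proof. by move=> v; exact: diff_transition_id. Qed.

(* The topology of the tangent space is the one that makes the linear
   bijections [dchart_inv h] homeomorphisms. *)
Record cotangent := Cotangent {
  cotangent_fun :> {linear tangent -> R^o} ;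
  cotangent_continuous : forall h : chart_at p,
    continuous (cotangent_fun \o dchart_inv h : H -> R^o)
}.

(* zeta = eta o dh^{-1}(h(p)) *)
Definition cotangent_coord (eta : cotangent) (h : chart_at p) (v : H) : R :=
  eta (dchart_inv h v).

End Tangent.

Record riemannian_metric (R : realType) (H : hilbertType R) (M : manifold H) :=
  RiemannianMetric {
  metric : forall p : M, tangent p -> tangent p -> R ;
  metricC : forall p (u v : tangent p), metric u v = metric v u ;
  metricDl : forall p (u v w : tangent p),
    metric (u + v) w = metric u w + metric v w ;
  metricZl : forall p (a : R) (u v : tangent p),
    metric (a *: u) v = a * metric u v ;
  metric_gt0 : forall p (u : tangent p), u != 0 -> 0 < metric u u ;
  metric_equivalent : forall p (h : chart_at p), exists c C : R,
    [/\ 0 < c, 0 < C & forall u : tangent p,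
      c * `|dchart h u| <= Num.sqrt (metric u u) <= C * `|dchart h u|] ;
  metric_smooth : forall h : chart H M, atlas h ->
    exists2 G : H -> clin H (clin H R^o),
      smooth_on (chart_img h) G &
      forall p (k : chart_at p), k = h :> chart H M ->
        forall v w : H, G (h p) v w = metric (dchart_inv k v) (dchart_inv k w)
}.

Section Differentiability.
Context {R : realType} {H : hilbertType R} {M : manifold H}.
Implicit Types (phi : M -> R) (p : M).

Definition C1 phi := forall h, atlas h ->
  Ck_on 1 (chart_img h) (phi \o chart_inv h : H -> R^o).

Definition frechet_differentiable phi p := forall h : chart_at p,
  differentiable (phi \o chart_inv h : H -> R^o) (h p).

(* d phi(p), computed in one chart; [mdiffE] is independence of the chart. *)
Definition mdiff phi p (v : tangent p) : R :=
  'd (phi \o chart_inv (some_chart p) : H -> R^o) (some_chart p p)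
     (dchart (some_chart p) v).

Lemma mdiffE phi p (h : chart_at p) (v : tangent p) :
  frechet_differentiable phi p ->
  mdiff phi v = 'd (phi \o chart_inv h : H -> R^o) (h p) (dchart h v).
Proof.
move=> /(_ (some_chart p)) dphi; rewrite /mdiff.
have [_ ->] := diff_chart_change (W := R^o) (u := phi) h dphi.
congr ('d _ _ _); rewrite /dchart; case: v => v /=.
by rewrite inE => /= vE; rewrite -vE.
Qed.

Lemma C1_differentiable phi p : C1 phi -> frechet_differentiable phi p.
Proof.
move=> phi1 h; have [df [ddf _]] := phi1 _ (chart_at_atlas h).
have hp : h p \in chart_img h.
  by rewrite inE; exists p => //; exact: chart_at_dom.
by have [] := ddf _ hp.
Qed.

End Differentiability.

Local Open Scope ereal_scope.

Section Subdifferential.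
Context {R : realType}.

Definition local_min_at (T : topologicalType) (u : T -> \bar R) (p : T) :=
  \forall x \near p, u p <= u x.

Definition local_max_at (T : topologicalType) (u : T -> \bar R) (p : T) :=
  \forall x \near p, u x <= u p.

Definition global_min_at (T : Type) (u : T -> \bar R) (p : T) :=
  forall x, u p <= u x.

Definition global_max_at (T : Type) (u : T -> \bar R) (p : T) :=
  forall x, u x <= u p.

Definition locally_bounded_below (T : topologicalType) (f : T -> \bar R) :=
  forall x : T, exists c : R, \forall y \near x, c%:E <= f y.

Definition locally_bounded_above (T : topologicalType) (f : T -> \bar R) :=
  forall x : T, exists c : R, \forall y \near x, f y <= c%:E.

Context {H : hilbertType R} {M : manifold H}.
Implicit Types (f : M -> \bar R) (p : M).

Definition subdifferential f p : set (cotangent p) :=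
  [set eta | exists phi : M -> R,
    [/\ C1 phi, local_min_at (fun x => f x - (phi x)%:E) p &
        eta = mdiff phi (p := p) :> (tangent p -> R)]].

Definition superdifferential f p : set (cotangent p) :=
  [set eta | exists phi : M -> R,
    [/\ C1 phi, local_max_at (fun x => f x - (phi x)%:E) p &
        eta = mdiff phi (p := p) :> (tangent p -> R)]].

Definition chart_quotient f p (eta : cotangent p) (h : chart_at p) (v : H) :
    \bar R :=
  (f (chart_inv h (h p + v)%R) - f p - (cotangent_coord eta h v)%:E)
    * (`|v|^-1)%:E.

End Subdifferential.

(* Main.v *)
(* Around [p], the inequality on the lower limit says that [f] stays above its
   first order expansion up to an error o(|v|), and such an error is bounded by
   a C^1 function with zero differential: a series of smoothed multiples of the
   norm. To extend this local function to [M] one needs chart balls to be closed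
   in [M], and for a global minimum one needs a C^1 minorant of [f]. Both rest on
   the Riemannian metric, since [M] is only assumed to be Hausdorff. A short
   segment of a chart cannot leave another chart ball (completeness of [H] and
   separation of [M]), so chart balls are closed and the topology is given by a
   distance. Stone's argument for the paracompactness of metric spaces then
   yields, at each level n, uniformly separated sets lying in charts; the
   Lasry-Lions regularization of the squared distance to such a set gives C^1
   bump functions without any separability assumption on [H]. Weighting and
   summing them produces a C^1 function s > 0 with -1/s <= f. Superdifferentials
   of [f] are subdifferentials of [-f]. *)
Require Import Defs.
From HB Require Import structures.
From mathcomp Require Import all_boot all_order all_algebra.
From mathcomp Require Import all_classical all_reals all_analysis.
From mathcomp Require Import ring lra.
From mathcomp Require wochoice.

Set Implicit Arguments.
Unset Strict Implicit.
Unset Printing Implicit Defensive.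

Import Order.TTheory GRing.Theory Num.Theory.
Import numFieldNormedType.Exports.

Local Open Scope classical_set_scope.
Local Open Scope ring_scope.

(** What shapes the constructions is that infinitely many functions must be added without local
    finiteness: each level of Stone's construction is discrete, but nothing controls how many levels
    are nonzero near a point. Every bump is therefore scaled to slope at most 1 for the Riemannian
    norm and weighted by 2^-(n+1). In a chart ball the tails of the series then have small Lipschitz
    constants, and with strict differentiability of the terms this is enough to make the sum C^1.
    The scaling needs a Lipschitz constant that depends neither on the set nor on the width of its
    neighborhood; the regularized squared distance provides one. No partition of unity is normalized
    either: the requirement s(x) a <= 1 is convex in s, so it passes from the levels to their
    weighted sum. *)

(** * Real induction and a mean value inequality *)

(** The supremum of the times up to which [P] holds is itself such a time by the last hypothesis,
    and by the extension hypothesis it cannot be smaller than [b]. *)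
Lemma real_induction (R : realType) (a b : R) (P : R -> Prop) :
  P a ->
  (forall t, a <= t < b -> (forall s, a <= s <= t -> P s) ->
    exists2 d, 0 < d & forall s, t < s < t + d -> P s) ->
  (forall t, a < t <= b -> (forall s, a <= s < t -> P s) -> P t) ->
  forall t, a <= t <= b -> P t.
Proof.
move=> Pa Pr Pl t0 /andP[at0 t0b]; have ab := le_trans at0 t0b.
pose T := [set t | a <= t <= b /\ forall s, a <= s <= t -> P s].
have Ta : T a.
  split=> [|s]; first by rewrite lexx ab.
  by rewrite -eq_le => /eqP <-.
have hT : has_sup T by split; [exists a|exists b => t [/andP[]]].
set m := sup T.
have am : a <= m by exact: sup_upper_bound.
have mb : m <= b by apply: sup_le_ub => [|t [/andP[]//]]; exists a.
have below s : a <= s < m -> P s.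
  move=> /andP[as_ sm]; have [t [_ tP] st] := sup_gt (ex_intro _ a Ta) sm.
  by apply: tP; rewrite as_ ltW.
have Pm : P m.
  have [<-//|am'] := eqVneq a m; apply: Pl => //.
  by rewrite mb lt_neqAle am' am.
have Tm s : a <= s <= m -> P s.
  by rewrite [s <= m]le_eqVlt => /andP[as_ /orP[/eqP->//|sm]]; apply: below; rewrite as_.
have [mb'|bm] := ltP m b; last by apply: Tm; rewrite at0 (le_trans t0b).
have [||d d0 dP] := Pr m; [by rewrite am|by []|].
pose t := m + Num.min (d / 2) (b - m).
have mt : m < t by rewrite ltrDl lt_min divr_gt0// subr_gt0.
have td : t < m + d.
  by rewrite ltrD2l gt_min; apply/orP; left; rewrite ltr_pdivrMr// mulr2n mulrDr mulr1 ltrDl.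
have tb : t <= b by rewrite -lerBrDl ge_min lexx orbT.
have : t <= m.
  apply: sup_upper_bound => //; split; first by rewrite tb (le_trans am) ?ltW.
  move=> s /andP[as_ st]; have [sm|ms] := leP s m; first by apply: Tm; rewrite as_.
  by apply: dP; rewrite ms (le_lt_trans st).
by rewrite leNgt mt.
Qed.

(** A mean value inequality without derivatives: the local slope bounds are chained by real
    induction, for each [K'] above [K]. It serves for C^1 maps and also for functions that are only
    Lipschitz along a path. *)
Lemma slope_bound (R : realType) (V : normedModType R) (psi : R -> V) (K a b : R) :
  a <= b ->
  (forall t, a <= t <= b -> forall K', K < K' ->
    \forall s \near t, a <= s <= b -> `|psi s - psi t| <= K' * `|s - t|) ->
  `|psi b - psi a| <= K * (b - a).
Proof.
move=> ab slope.
suff H K' : K < K' -> `|psi b - psi a| <= K' * (b - a).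
  apply/ler_addgt0Pr => e e0.
  have ba1 : 0 < b - a + 1 by lra.
  have := H (K + e / (b - a + 1)); rewrite ltrDl divr_gt0// => /(_ isT)/le_trans; apply.
  rewrite mulrDl lerD2l mulrAC -mulrA ler_piMr ?(ltW e0)//.
  by rewrite ler_pdivrMr// mul1r lerDl.
move=> KK'.
apply: (@real_induction _ a b (fun t => `|psi t - psi a| <= K' * (t - a))).
- by rewrite !subrr normr0 mulr0.
- move=> t /andP[at_ tb] IH.
  have tab : a <= t <= b by rewrite at_ ltW.
  have /nbhs_ballP[d /= d0 dP] := slope t tab K' KK'.
  exists (Num.min d (b - t)); first by rewrite lt_min d0 subr_gt0.
  move=> s /andP[ts]; rewrite -ltrBlDl lt_min => /andP[sd sb].
  have sB : ball t d s by rewrite -ball_normE /= distrC ger0_norm; lra.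
  have sab : a <= s <= b by apply/andP; split; lra.
  have := dP s sB sab; rewrite (ger0_norm (_ : 0 <= s - t)); last lra.
  have := IH t; rewrite at_ lexx => /(_ isT) h1 h2.
  rewrite (_ : psi s - psi a = (psi s - psi t) + (psi t - psi a)); last by rewrite addrA subrK.
  apply: le_trans (ler_normD _ _) _; lra.
- move=> t /andP[at_ tb] IH.
  have tab : a <= t <= b by rewrite tb ltW.
  have /nbhs_ballP[d /= d0 dP] := slope t tab K' KK'.
  pose s := Num.max a (t - d / 2).
  have as_ : a <= s by rewrite le_max lexx.
  have st : s < t by rewrite gt_max at_ /=; lra.
  have sd : t - d < s by rewrite lt_max; apply/orP; right; lra.
  have sB : ball t d s by rewrite -ball_normE /= ger0_norm; lra.
  have sab : a <= s <= b by apply/andP; split; lra.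
  have := dP s sB sab; rewrite distrC (distrC s) (ger0_norm (_ : 0 <= t - s)); last lra.
  have := IH s; rewrite as_ st => /(_ isT) h1 h2.
  rewrite (_ : psi t - psi a = (psi t - psi s) + (psi s - psi a)); last by rewrite addrA subrK.
  apply: le_trans (ler_normD _ _) _; lra.
- by rewrite ab lexx.
Qed.

(** * Strict differentiability *)

Section LinearFacts.
Context {R : realType} {V W : normedModType R} (L : V -> W).

(** A predicate on bare functions, unlike the bundled [clin], so that differentials can be written
    as explicit lambda terms. *)
Definition blin := linear L /\ exists2 C, 0 <= C & forall v, `|L v| <= C * `|v|.

Hypothesis lL : linear L.

Lemma lin0 : L 0 = 0.
Proof. by have := lL (-1) 0 0; rewrite scaler0 addr0 scaleN1r addNr. Qed.

Lemma linD u v : L (u + v) = L u + L v.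
Proof. by rewrite -[u in LHS]scale1r lL scale1r. Qed.

Lemma linZ a u : L (a *: u) = a *: L u.
Proof. by rewrite -[a *: u]addr0 lL lin0 addr0. Qed.

Lemma linN u : L (- u) = - L u.
Proof. by rewrite -scaleN1r linZ scaleN1r. Qed.

Lemma linB u v : L (u - v) = L u - L v.
Proof. by rewrite linD linN. Qed.

End LinearFacts.

Lemma blin_cst0 (R : realType) (V W : normedModType R) : blin (fun _ : V => 0 : W).
Proof.
split=> [a u v|]; first by rewrite scaler0 addr0.
by exists 0 => // v; rewrite normr0 mul0r.
Qed.

Section Sdiff.
Context {R : realType}.
Implicit Types V W U : normedModType R.

Definition sapprox V W (f : V -> W) x e (L : V -> W) :=
  exists2 d, 0 < d & forall y z, `|y - x| < d -> `|z - x| < d ->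
    `|f y - f z - L (y - z)| <= e * `|y - z|.

(* Strict differentiability.  On an open set it is the same as being C^1, but
   its calculus needs neither the continuity of the differential nor the mean
   value inequality. *)
Definition sdiff V W (f : V -> W) x L := blin L /\ forall e, 0 < e -> sapprox f x e L.

Definition liploc V W (f : V -> W) x C :=
  exists2 d, 0 < d & forall y z, `|y - x| < d -> `|z - x| < d ->
    `|f y - f z| <= C * `|y - z|.

Lemma sapprox_lip V W (f : V -> W) x e C L : (forall v, `|L v| <= C * `|v|) ->
  sapprox f x e L -> liploc f x (C + e).
Proof.
move=> LC [d d0 fd]; exists d => // y z yx zx.
rewrite -[X in `|X|](subrK (L (y - z))) (le_trans (ler_normD _ _))// mulrDl addrC.
by rewrite lerD ?fd.
Qed.

Lemma sdiff_lip V W (f : V -> W) x L : sdiff f x L ->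
  exists2 C, 0 < C & liploc f x C.
Proof.
move=> [[_ [C C0 LC]] fL]; exists (C + 1); first by rewrite ltr_wpDl.
exact: sapprox_lip LC (fL _ ltr01).
Qed.

Lemma sdiff_near V W (f g : V -> W) x L : (\forall y \near x, f y = g y) ->
  sdiff f x L -> sdiff g x L.
Proof.
move=> /nbhs_ballP[d1 /= d10 fg] [bL fL]; split=> // e /fL[d d0 fd].
exists (Num.min d1 d) => [|y z]; first by rewrite lt_min d10.
rewrite !lt_min => /andP[y1 y2] /andP[z1 z2].
by rewrite -!fg ?fd// -ball_normE /= distrC.
Qed.

Lemma sdiff_cst V W (a : W) (x : V) : sdiff (fun _ => a) x (fun _ => 0).
Proof.
split; first exact: blin_cst0.
move=> e e0; exists 1 => // y z _ _.
by rewrite !subrr normr0 mulr_ge0// ltW.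
Qed.

Lemma sdiff_blin V W (L : V -> W) x : blin L -> sdiff L x L.
Proof.
move=> bL; split=> // e e0; exists 1 => // y z _ _.
by rewrite -linB ?subrr ?normr0 ?mulr_ge0// ?(ltW e0)//; case: bL.
Qed.

Lemma sdiffD V W (f g : V -> W) x L M : sdiff f x L -> sdiff g x M ->
  sdiff (fun y => f y + g y) x (fun v => L v + M v).
Proof.
move=> [[lL [C C0 LC]] fL] [[lM [D D0 MD]] gM]; split.
  split=> [a u v|]; first by rewrite lL lM scalerDr addrACA.
  exists (C + D) => [|v]; first exact: addr_ge0.
  by rewrite (le_trans (ler_normD _ _))// mulrDl lerD.
move=> e e0; have e20 : 0 < e / 2 by lra.
have [d1 d10 fd] := fL _ e20; have [d2 d20 gd] := gM _ e20.
exists (Num.min d1 d2) => [|y z]; first by rewrite lt_min d10.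
rewrite !lt_min => /andP[y1 y2] /andP[z1 z2].
have h1 := fd _ _ y1 z1; have h2 := gd _ _ y2 z2.
rewrite [X in `|X|](_ : _ = (f y - f z - L (y - z)) + (g y - g z - M (y - z))).
  by rewrite (le_trans (ler_normD _ _))//; lra.
by rewrite [RHS]addrACA [f y - f z + _]addrACA -!opprD.
Qed.

Lemma sdiff_comp V W U (f : V -> W) (g : W -> U) x L M :
  sdiff f x L -> sdiff g (f x) M -> sdiff (g \o f) x (M \o L).
Proof.
move=> sf; have [K K0 [d0 d00 fK]] := sdiff_lip sf.
move: sf => [[lL [C C0 LC]] fL] [[lM [D D0 MD]] gM]; split.
  split=> [a u v|] /=; first by rewrite lL lM.
  exists (D * C) => [|v]; first exact: mulr_ge0.
  by rewrite /= (le_trans (MD _))// -mulrA ler_wpM2l.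
move=> e e0.
have D10 : 0 < D + 1 by lra.
have [d1 d10 fd] := fL (e / 2 / (D + 1)) ltac:(by rewrite !divr_gt0).
have [d2 d20 gd] := gM (e / 2 / K) ltac:(by rewrite !divr_gt0).
exists (Num.min d0 (Num.min d1 (d2 / K))) => [|y z].
  by rewrite !lt_min d00 d10 divr_gt0.
rewrite !lt_min => /and3P[y0 y1 y2] /and3P[z0 z1 z2] /=.
have fx0 u : `|u - x| < d0 -> `|u - x| < d2 / K -> `|f u - f x| < d2.
  move=> u0 u2; rewrite (le_lt_trans (fK _ _ u0 _)) ?subrr ?normr0//.
  by rewrite mulrC -ltr_pdivlMr.
have h1 := fd _ _ y1 z1; have h2 := gd _ _ (fx0 _ y0 y2) (fx0 _ z0 z2).
have h3 := fK _ _ y0 z0.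
rewrite [X in `|X|](_ : _ = (g (f y) - g (f z) - M (f y - f z))
   + M (f y - f z - L (y - z))); last by rewrite (linB lM (f y - f z)) addrA subrK.
rewrite (le_trans (ler_normD _ _))//.
have h4 : e / 2 / K * `|f y - f z| <= e / 2 * `|y - z|.
  by rewrite -mulrA ler_wpM2l// ?divr_ge0 ?(ltW e0)// ler_pdivrMl.
have h5 : `|M (f y - f z - L (y - z))| <= e / 2 * `|y - z|.
  rewrite (le_trans (MD _))// (@le_trans _ _ ((D + 1) * `|f y - f z - L (y - z)|))//.
    by rewrite ler_wpM2r// lerDl.
  by rewrite -ler_pdivlMl//; apply: le_trans h1 _; rewrite mulrA [_^-1 * _]mulrC.
by move: h2 h4 h5; lra.
Qed.

Lemma sdiff_scalar (phi : R -> R) (t c : R) :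
  (forall e, 0 < e -> exists2 d, 0 < d & forall s s', `|s - t| < d -> `|s' - t| < d ->
     `|phi s - phi s' - c * (s - s')| <= e * `|s - s'|) ->
  sdiff phi t (fun h => c * h).
Proof.
move=> H; split=> //; split=> [a u v|].
  by rewrite mulrDr [_ *: _]/(_ * _) [_ *: _ in RHS]/(_ * _) mulrCA.
by exists `|c| => // v; rewrite normrM.
Qed.

(** For a scalar function, strict differentiability follows from a two-point difference quotient
    that is continuous at the diagonal; inverse and square root then reduce to an algebraic
    identity. *)
Lemma sdiff_quotient (phi : R -> R) (q : R * R -> R) (t : R) :
  (\forall p \near (t, t), phi p.1 - phi p.2 = q p * (p.1 - p.2)) ->
  {for (t, t), continuous q} -> sdiff phi t (fun h => q (t, t) * h).
Proof.
move=> phiq qc; apply: sdiff_scalar => e e0.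
have := qc; move/cvgrPdist_le => /(_ e e0) qe.
have : \forall p \near (t, t), `|phi p.1 - phi p.2 - q (t, t) * (p.1 - p.2)|
    <= e * `|p.1 - p.2|.
  apply: filterS2 phiq qe => p -> pe.
  by rewrite -mulrBl normrM ler_wpM2r// distrC.
move=> /nbhs_ballP[d /= d0 dP]; exists d => // s s' sd s'd.
by apply: (dP (s, s')); split; rewrite -ball_normE /= distrC.
Qed.

(** A C^1 function that is positive exactly on the positive half-line: the source of all bumps and
    cutoffs below. *)
Definition pos2 (t : R) := Num.max 0 t ^+ 2.

Lemma sdiff_pos2 (t : R) : sdiff pos2 t (fun h => 2 * Num.max 0 t * h).
Proof.
apply: sdiff_scalar => e e0; exists (e / 2); first by lra.
move=> s s'; rewrite !ltr_distl => /andP[s1 s2] /andP[t1 t2].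
rewrite /pos2.
have [ss'|ss'] := leP s s'; [rewrite (distrC s) (ger0_norm (_ : 0 <= s' - s))|
  rewrite (ger0_norm (_ : 0 <= s - s'))]; try lra;
rewrite ler_norml; case: (leP 0 t) => ?; case: (leP 0 s) => ?;
  case: (leP 0 s') => ?; apply/andP; split; nra.
Qed.

Lemma pos2_ge0 t : 0 <= pos2 t. Proof. exact: sqr_ge0. Qed.

Lemma pos2_le0 t : t <= 0 -> pos2 t = 0.
Proof. by move=> t0; rewrite /pos2 (max_idPl t0) expr0n. Qed.

Lemma pos2_gt0 t : 0 < t -> 0 < pos2 t.
Proof. by move=> t0; rewrite /pos2 (max_idPr (ltW t0)) exprn_gt0. Qed.

Lemma pos2_le1 t : t <= 1 -> pos2 t <= 1.
Proof. by move=> t1; rewrite /pos2 expr_le1// ?le_max ?lexx// ge_max ler01. Qed.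

Lemma pos2_ge1 t : 1 <= t -> 1 <= pos2 t.
Proof. by move=> t1; rewrite /pos2 exprn_ege1// le_max t1 orbT. Qed.

Lemma pos2_lip s t : s <= 1 -> t <= 1 -> `|pos2 s - pos2 t| <= 2 * `|s - t|.
Proof.
move=> s1 t1; rewrite /pos2.
have [st|st] := leP s t; [rewrite (distrC s) (ger0_norm (_ : 0 <= t - s))|
  rewrite (ger0_norm (_ : 0 <= s - t))]; try lra;
rewrite ler_norml; case: (leP 0 s) => ?; case: (leP 0 t) => ?; apply/andP; split; nra.
Qed.

Lemma sdiff_inv (t : R) : t != 0 -> exists c, sdiff (fun s : R => s^-1) t (fun h => c * h).
Proof.
move=> t0; eexists; apply: (@sdiff_quotient _ (fun p => - (p.1 * p.2)^-1)).
  have c1 : {for (t, t), continuous (fun p : R * R => p.1)} by exact: cvg_fst.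
  have c2 : {for (t, t), continuous (fun p : R * R => p.2)} by exact: cvg_snd.
  have n1 : \forall p \near (t, t), p.1 != 0 by exact: cvgr_neq0 c1 t0.
  have n2 : \forall p \near (t, t), p.2 != 0 by exact: cvgr_neq0 c2 t0.
  by apply: filterS2 n1 n2 => p p1 p2; field; rewrite p1 p2.
apply: cvgN; apply: cvgV; first by rewrite mulf_neq0.
by apply: cvgM; [exact: cvg_fst|exact: cvg_snd].
Qed.

Lemma sdiff_sqrt (t : R) : 0 < t -> exists c, sdiff (fun s : R => Num.sqrt s) t (fun h => c * h).
Proof.
move=> t0; eexists.
apply: (@sdiff_quotient _ (fun p => (Num.sqrt p.1 + Num.sqrt p.2)^-1)).
  have c1 : {for (t, t), continuous (fun p : R * R => p.1)} by exact: cvg_fst.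
  have c2 : {for (t, t), continuous (fun p : R * R => p.2)} by exact: cvg_snd.
  have n1 : \forall p \near (t, t), 0 < p.1 by exact: (cvgr_gt _ c1 _ t0).
  have n2 : \forall p \near (t, t), 0 < p.2 by exact: (cvgr_gt _ c2 _ t0).
  apply: filterS2 n1 n2 => p p1 p2.
  rewrite -[X in _ * (X - _)]sqr_sqrtr ?(ltW p1)// -[X in _ * (_ - X)]sqr_sqrtr ?(ltW p2)//.
  have h1 : 0 < Num.sqrt p.1 by rewrite sqrtr_gt0.
  have h2 : 0 < Num.sqrt p.2 by rewrite sqrtr_gt0.
  by field; apply: lt0r_neq0; rewrite addr_gt0.
have st : 0 < Num.sqrt t by rewrite sqrtr_gt0.
apply: cvgV; first by rewrite lt0r_neq0// addr_gt0.
apply: cvgD; [apply: (@cvg_comp _ _ _ fst Num.sqrt _ (nbhs t))|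
  apply: (@cvg_comp _ _ _ snd Num.sqrt _ (nbhs t))]; try exact: sqrt_continuous;
  [exact: cvg_fst|exact: cvg_snd].
Qed.

Lemma sdiffM V (f g : V -> R) x L M : sdiff f x L -> sdiff g x M ->
  sdiff (fun y => f y * g y) x (fun v => f x * M v + g x * L v).
Proof.
move=> sf sg; have [C1 C10 [a0 a00 fC]] := sdiff_lip sf.
have [C2 C20 [b0 b00 gC]] := sdiff_lip sg.
move: sf sg => [[lL [C C0 LC]] fL] [[lM [D D0 MD]] gM]; split.
  split=> [a u v|].
    have E (b c l l' m m' : R) : b * (a * m + m') + c * (a * l + l') =
      a * (b * m + c * l) + (b * m' + c * l') by ring.
    by rewrite lL lM; exact: E.
  exists (`|f x| * D + `|g x| * C) => [|v]; first by rewrite addr_ge0// mulr_ge0.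
  by rewrite (le_trans (ler_normD _ _))// mulrDl lerD// normrM -mulrA ler_wpM2l.
move=> e e0.
have f10 : 0 < `|f x| + 1 by rewrite ltr_wpDl.
have g10 : 0 < `|g x| + 1 by rewrite ltr_wpDl.
have e40 : 0 < e / 4 by lra.
have [d1 d10 fd] := fL (e / 4 / (`|g x| + 1)) ltac:(by rewrite divr_gt0).
have [d2 d20 gd] := gM (e / 4 / (`|f x| + 1)) ltac:(by rewrite divr_gt0).
exists (Num.min (Num.min a0 b0) (Num.min (Num.min d1 d2) (e / 4 / (C1 * C2)))) => [|y z].
  by rewrite !lt_min a00 b00 d10 d20 /= !(divr_gt0, mulr_gt0).
rewrite !lt_min => /andP[/andP[ya yb] /andP[/andP[y1 y2] y3]].
move=> /andP[/andP[za zb] /andP[/andP[z1 z2] z3]].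
have h1 := fd _ _ y1 z1; have h2 := gd _ _ y2 z2.
(* The first two terms are the strict errors of the factors; the last two are products of
   increments, small because one increment is measured from [x]. *)
have E (a a1 a2 b b1 b2 l m : R) : a1 * b1 - a2 * b2 - (a * m + b * l) =
  a * (b1 - b2 - m) + b * (a1 - a2 - l) + (a1 - a) * (b1 - b2) + (b2 - b) * (a1 - a2).
  by ring.
have hf u : `|u - x| < a0 -> `|f u - f x| <= C1 * `|u - x|.
  by move=> ua; apply: fC => //; rewrite subrr normr0.
have hg u : `|u - x| < b0 -> `|g u - g x| <= C2 * `|u - x|.
  by move=> ua; apply: gC => //; rewrite subrr normr0.
rewrite [X in `|X|](_ : _ = f x * (g y - g z - M (y - z))
   + g x * (f y - f z - L (y - z)) + (f y - f x) * (g y - g z)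
   + (g z - g x) * (f y - f z)); last exact: E.
have H1 : `|f x * (g y - g z - M (y - z))| <= e / 4 * `|y - z|.
  rewrite normrM (@le_trans _ _ ((`|f x| + 1) * `|g y - g z - M (y - z)|))//.
    by rewrite ler_wpM2r// lerDl.
  by rewrite -ler_pdivlMl// mulrA [_^-1 * _]mulrC.
have H2 : `|g x * (f y - f z - L (y - z))| <= e / 4 * `|y - z|.
  rewrite normrM (@le_trans _ _ ((`|g x| + 1) * `|f y - f z - L (y - z)|))//.
    by rewrite ler_wpM2r// lerDl.
  by rewrite -ler_pdivlMl// mulrA [_^-1 * _]mulrC.
have K u : `|u - x| < e / 4 / (C1 * C2) -> C1 * `|u - x| * C2 <= e / 4.
  by rewrite ltr_pdivlMr ?mulr_gt0// => /ltW; rewrite mulrA [C1 * _]mulrC.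
have H3 : `|(f y - f x) * (g y - g z)| <= e / 4 * `|y - z|.
  rewrite normrM (le_trans (ler_pM _ _ (hf _ ya) (gC _ _ yb zb)))//.
  by rewrite mulrA ler_wpM2r// K.
have H4 : `|(g z - g x) * (f y - f z)| <= e / 4 * `|y - z|.
  rewrite normrM (le_trans (ler_pM _ _ (hg _ zb) (fC _ _ ya za)))//.
  by rewrite mulrA ler_wpM2r// -mulrA mulrC mulrAC mulrC mulrA K.
do 3 ?[apply: le_trans (ler_normD _ _) _]; move: H1 H2 H3 H4.
have := ler_normD (f x * (g y - g z - M (y - z)) + g x * (f y - f z - L (y - z)))
  ((f y - f x) * (g y - g z)).
have := ler_normD (f x * (g y - g z - M (y - z))) (g x * (f y - f z - L (y - z))).
lra.
Qed.

End Sdiff.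

Section ScalarSdiff.
Context {R : realType} {V : normedModType R}.
Implicit Types (f : V -> R) (x : V).

Lemma linZR f : linear f -> forall a u, f (a *: u) = a * f u.
Proof. exact: linZ. Qed.

Lemma linDR f : linear f -> forall u v, f (u + v) = f u + f v.
Proof. exact: linD. Qed.

Lemma linBR f : linear f -> forall u v, f (u - v) = f u - f v.
Proof. exact: linB. Qed.

Lemma linNR f : linear f -> forall u, f (- u) = - f u.
Proof. exact: linN. Qed.

Lemma linPR f : linear f -> forall a u v, f (a *: u + v) = a * f u + f v.
Proof. by move=> lf; exact: lf. Qed.

Lemma linear_scalar f : (forall a u v, f (a *: u + v) = a * f u + f v) -> linear f.
Proof. by []. Qed.

Lemma le0_forall_eps (a b : R) : (forall e, 0 < e -> a <= e * b) -> a <= 0.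
Proof.
move=> H; apply/ler_addgt0Pr => e e0; rewrite add0r.
have b1 : 0 < `|b| + 1 by rewrite ltr_wpDl.
have := H (e / (`|b| + 1)) ltac:(by rewrite divr_gt0).
move=> /le_trans; apply; rewrite mulrAC -mulrA ler_piMr ?(ltW e0)//.
by rewrite ler_pdivrMr// mul1r (le_trans (ler_norm b))// lerDl.
Qed.

(* The approximate differentials form a Cauchy family, whose limit is the
   differential. *)
Lemma sdiff_approx f x :
  (forall e, 0 < e -> exists2 L : V -> R, blin L & sapprox f x e L) ->
  exists L : V -> R, sdiff f x L.
Proof.
move=> H.
have /choice[F FP] (e : R) : exists L : V -> R, 0 < e -> blin L /\ sapprox f x e L.
  have [e0|e0] := ltP 0 e; last by exists (fun _ => 0).
  by have [L bL fL] := H e e0; exists L.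
have close e e' v : 0 < e -> 0 < e' -> F e v - e * `|v| <= F e' v + e' * `|v|.
  move=> e0 e'0; have [[lL _] [d1 d10 fd1]] := FP e e0.
  have [[lL' _] [d2 d20 fd2]] := FP e' e'0.
  have [->|v0] := eqVneq v 0; first by rewrite !(lin0 lL) !(lin0 lL') normr0; lra.
  have nv : 0 < `|v| by rewrite normr_gt0.
  (* Both approximations can be compared on a multiple of [v] short enough for the two radii;
     homogeneity carries the comparison back to [v]. *)
  pose t := Num.min d1 d2 / 2 / `|v|.
  have md : 0 < Num.min d1 d2 by rewrite lt_min d10.
  have t0 : 0 < t by rewrite !divr_gt0.
  have tv : `|(t *: v + x) - x| = Num.min d1 d2 / 2.
    by rewrite addrK normrZ gtr0_norm// /t divfK// gt_eqF.
  have m2 : Num.min d1 d2 / 2 < Num.min d1 d2 by lra.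
  have y1 : `|(t *: v + x) - x| < d1 by rewrite tv (lt_le_trans m2)// ge_min lexx.
  have y2 : `|(t *: v + x) - x| < d2 by rewrite tv (lt_le_trans m2)// ge_min lexx orbT.
  have := fd1 _ x y1; rewrite subrr normr0 => /(_ d10).
  have := fd2 _ x y2; rewrite subrr normr0 => /(_ d20).
  rewrite addrK !(linZR lL) !(linZR lL').
  rewrite normrZ (gtr0_norm t0) !ler_norml => /andP[h1 h2] /andP[h3 h4].
  rewrite -(ler_pM2l t0). lra.
(* By [close], the intervals with centre [F e v] and radius e|v| meet pairwise, so the supremum of
   their left ends lies in all of them. *)
pose L v := sup [set F e v - e * `|v| | e in [set e | 0 < e]].
have Lub e v : 0 < e -> L v <= F e v + e * `|v|.
  move=> e0; apply: ge_sup; first by exists (F 1 v - 1 * `|v|), 1 => //=; exact: ltr01.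
  by move=> _ [e' e'0 <-]; exact: close.
have Llb e v : 0 < e -> F e v - e * `|v| <= L v.
  move=> e0; apply: ub_le_sup; last by exists e.
  by exists (F 1 v + 1 * `|v|) => _ [e' e'0 <-]; apply: close => //; exact: ltr01.
have LF e v : 0 < e -> `|L v - F e v| <= e * `|v|.
  by move=> e0; rewrite ler_norml; have := Lub e v e0; have := Llb e v e0; lra.
exists L; split; first split.
- apply: linear_scalar => a u v; apply/eqP; rewrite -subr_eq0 -normr_le0.
  apply: (@le0_forall_eps _ (`|a *: u + v| + `|a| * `|u| + `|v|)) => e e0.
  have [[lL _] _] := FP e e0.
  have h1 := LF e (a *: u + v) e0; have h2 := LF e u e0; have h3 := LF e v e0.
  have h4 : `|a * (L u - F e u)| <= e * (`|a| * `|u|).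
    by rewrite normrM mulrCA ler_wpM2l.
  move: h1 h3 h4; rewrite (linPR lL).
  by rewrite !ler_norml; move: (`|a *: u + v|) (`|u|) (`|v|) => p q r; lra.
- have [[lL [C C0 LC]] _] := FP 1 ltr01.
  exists (C + 1) => [|v]; first by rewrite addr_ge0.
  by have := LF 1 v ltr01; have := LC v; rewrite !ler_norml; lra.
- move=> e e0; have e20 : 0 < e / 2 by lra.
  have [_ [d d0 fd]] := FP _ e20; exists d => // y z yd zd.
  by have := fd _ _ yd zd; have := LF _ (y - z) e20; rewrite !ler_norml; lra.
Qed.

Lemma exists_half_pow (C e : R) : 0 < e -> exists N, C * 2^-1 ^+ N <= e.
Proof.
move=> e0; exists (Num.bound `|C / e|); set N := Num.bound _.
have CN : `|C / e| < 2 ^+ N.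
  by rewrite (lt_le_trans (archi_boundP (normr_ge0 _)))// -natrX ler_nat ltnW// ltn_expl.
rewrite exprVn ler_pdivrMr ?exprn_gt0// mulrC -ler_pdivrMr//.
by rewrite (le_trans (ler_norm _))// ltW.
Qed.

Lemma sdiff_sum (u : nat -> V -> R) x : (forall n, exists L : V -> R, sdiff (u n) x L) ->
  forall n, exists L : V -> R, sdiff (fun y => \sum_(0 <= i < n) u i y) x L.
Proof.
move=> H; elim=> [|n [L IH]].
  exists (fun _ => 0); rewrite (_ : (fun y => _) = fun _ => 0); first exact: sdiff_cst.
  by apply/funext => y; rewrite big_nil.
have [M uM] := H n; exists (fun v => L v + M v).
rewrite (_ : (fun y => _) = fun y => (\sum_(0 <= i < n) u i y) + u n y); first exact: sdiffD.
by apply/funext => y; rewrite big_nat_recr.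
Qed.

(** Beyond [N] the tail has Lipschitz constant 2K 2^-N near [x], so the differential of a partial
    sum is an approximate strict differential of [s], and [sdiff_approx] concludes. Convergence of
    the differentials never has to be discussed. *)
Lemma sdiff_series (u : nat -> V -> R) (s : V -> R) x K d0 : 0 < d0 -> 0 <= K ->
  (forall n y z, `|y - x| < d0 -> `|z - x| < d0 ->
     `|u n y - u n z| <= K * 2^-1 ^+ n * `|y - z|) ->
  (forall n, exists L : V -> R, sdiff (u n) x L) ->
  (forall y, `|y - x| < d0 -> series (u^~ y) @ \oo --> s y) ->
  exists L : V -> R, sdiff s x L.
Proof.
move=> d00 K0 uK ud us; apply: sdiff_approx => e e0.
have [N NK] := @exists_half_pow (2 * K) (e / 2) ltac:(by lra).
have [L [bL SL]] := sdiff_sum ud N; exists L => //.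
have [d dp Sd] := SL (e / 2) ltac:(by lra).
exists (Num.min d d0) => [|y z]; first by rewrite lt_min dp.
rewrite !lt_min => /andP[y1 y2] /andP[z1 z2].
have := Sd _ _ y1 z1; rewrite -/(series (u^~ y) N) -/(series (u^~ z) N) => h1.
pose T n := series (u^~ y) n - series (u^~ z) n.
have TN n : `|T (n + N)%N - T N| <= K * (2 * 2^-1 ^+ N - 2 * 2^-1 ^+ (n + N)) * `|y - z|.
  elim: n => [|n IH]; first by rewrite add0n !subrr normr0 mulr0 mul0r.
  have := uK (n + N)%N _ _ y2 z2.
  move: IH; rewrite /T /series /= addSn !(@big_nat_recr _ _ _ (n + N)%N)//= exprS.
  by rewrite !ler_norml => /andP[h2 h3] /andP[h4 h5]; apply/andP; split; lra.
have TL : T n @[n --> \oo] --> s y - s z by apply: cvgB; exact: us.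
have h2 : `|s y - s z - T N| <= 2 * K * 2^-1 ^+ N * `|y - z|.
  have TL' : `|T n - T N| @[n --> \oo] --> `|s y - s z - T N|.
    by apply: cvg_norm; apply: cvgB => //; exact: cvg_cst.
  rewrite -(cvg_lim _ TL')//; apply: limr_le; first by apply/cvg_ex; eexists; exact: TL'.
  exists N => // n /= Nn; rewrite -(subnK Nn) (le_trans (TN _))// ler_wpM2r//.
  rewrite mulrBr -!mulrA mulrCA gerBl mulr_ge0// mulr_ge0// exprn_ge0// invr_ge0 ler0n.
rewrite -[X in `|X|](subrK (T N)) in h1 *.
have h3 : 2 * K * 2^-1 ^+ N * `|y - z| <= e / 2 * `|y - z| by rewrite ler_wpM2r.
rewrite (_ : s y - s z - L (y - z) = (s y - s z - T N) + (T N - L (y - z))).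
  by rewrite (le_trans (ler_normD _ _))//; move: h1 h2 h3; rewrite subrK /T; lra.
by rewrite addrA subrK.
Qed.

(* On the ball of radius [eta] around [x], the function [w - l] is O(eta^2), so
   that its own approximate subgradients are O(eta): hence the approximate
   subgradient [l] at [x] is an approximate strict differential. *)
Lemma sdiff_semiconvex_semiconcave (w : V -> R) K : 0 <= K ->
  (forall x e, 0 < e -> exists2 l : V -> R, blin l &
     forall u, w x - e + l u - K * `|u| ^+ 2 <= w (x + u)) ->
  (forall x u, w (x + u) + w (x - u) <= 2 * w x + K * `|u| ^+ 2) ->
  forall x, exists L : V -> R, sdiff w x L.
Proof.
move=> K0 wb wc x; apply: sdiff_approx => e e0.
(* The errors add up to (2 + 19K) eta per unit of length: (2 + 16K) eta from 2M / eta, K eta from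
   the quadratic error of a step of length [eta], and 2K eta from that of the step [h]. *)
pose eta := e / (2 + 19 * K).
have eta0 : 0 < eta by rewrite divr_gt0//; lra.
have [l bl lP] := wb x (eta ^+ 2) ltac:(by rewrite exprn_gt0).
have ll := bl.1; exists l => //; exists eta => //.
pose F u := w (x + u) - w x - l u.
pose M := eta ^+ 2 + 8 * K * eta ^+ 2.
have FM u : `|u| <= 2 * eta -> `|F u| <= M.
  move=> u2; have := lP u; have := lP (- u); have := wc x u.
  rewrite (linNR ll) normrN /F /M => h1 h2 h3.
  have : K * `|u| ^+ 2 <= 4 * K * eta ^+ 2.
    rewrite (_ : 4 * K * eta ^+ 2 = K * (2 * eta) ^+ 2); last by ring.
    by rewrite ler_wpM2l// ler_pXn2r ?nnegrE// mulr_ge0// ltW.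
  have Ke : 0 <= K * eta ^+ 2 by rewrite mulr_ge0// sqr_ge0.
  by rewrite ler_norml; move: (`|u| ^+ 2) h1 h2 h3 => U; lra.
have key u u' : `|u| < eta -> `|u'| < eta -> F u' - F u <= e * `|u - u'|.
  move=> ue u'e; have [->|uu'] := eqVneq u u'; first by rewrite !subrr normr0 mulr0.
  pose h := u - u'; have h0 : 0 < `|h| by rewrite normr_gt0 subr_eq0.
  have h2e : `|h| < 2 * eta by rewrite (le_lt_trans (ler_normB _ _))//; lra.
  rewrite -subr_le0; apply: (@le0_forall_eps _ (1 + `|h| / eta)) => e' e'0.
  have [l' bl' l'P] := wb (x + u') e' e'0; have ll' := bl'.1.
  pose G k := l' k - l k.
  have FG k : F u' - e' + G k - K * `|k| ^+ 2 <= F (u' + k).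
    by have := l'P k; rewrite /F /G (linDR ll) [x + (_ + _)]addrA; lra.
  have hu : u' + h = u by rewrite /h addrC subrK.
  have := FG h; rewrite hu => h1.
  (* The difference [G] of the two subgradients is bounded below along [h] by testing it in the
     opposite direction at full length [eta], where [F] is known to be at most [M] in absolute
     value. *)
  pose k := - (eta / `|h|) *: h.
  have nk : `|k| = eta.
    by rewrite /k normrZ normrN (gtr0_norm (divr_gt0 eta0 h0)) divfK// gt_eqF.
  have Gk : G k = - (eta / `|h|) * G h.
    by rewrite /G /k (linZR ll) (linZR ll') mulrBr.
  have := FG k; rewrite nk Gk => h2.
  have uk2 : `|u' + k| <= 2 * eta.
    by rewrite (le_trans (ler_normD _ _))// nk; lra.
  have := FM _ uk2.
  have := FM u' ltac:(by lra).
  rewrite !ler_norml => /andP[m1 m2] /andP[m3 m4].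
  have GH : - (eta / `|h| * G h) <= 2 * M + e' + K * eta ^+ 2 by lra.
  have GH' : - G h <= (2 * M + e' + K * eta ^+ 2) * (`|h| / eta).
    rewrite (_ : - G h = - (eta / `|h| * G h) * (`|h| / eta)); last first.
      by field; rewrite !gt_eqF.
    by rewrite ler_wpM2r// divr_ge0// ltW.
  have hh : K * `|h| ^+ 2 <= K * (2 * eta) * `|h|.
    by rewrite expr2 [leLHS]mulrA ler_wpM2r// ler_wpM2l// ltW.
  have E : (2 * M + e' + K * eta ^+ 2) * (`|h| / eta) + K * (2 * eta) * `|h| =
      e' * (`|h| / eta) + e * `|h|.
    rewrite /M (_ : e = eta * (2 + 19 * K)); last by rewrite divfK//; apply: lt0r_neq0; lra.
    by field; rewrite gt_eqF.
  by move: h1 GH' hh E; lra.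
move=> y z yx zx.
have E a b : w a - w b - l (a - b) = F (a - x) - F (b - x).
  by rewrite /F ![x + (_ - x)]addrC !subrK !(linBR ll); lra.
have h1 := key _ _ yx zx; have h2 := key _ _ zx yx.
have Exy (a b : V) : a - x - (b - x) = a - b by rewrite opprB addrA subrK.
rewrite Exy in h1; rewrite Exy distrC in h2.
by rewrite E ler_norml; lra.
Qed.

End ScalarSdiff.

Section StrictlyDifferentiable.
Context {R : realType} {V : normedModType R}.
Implicit Types (f g : V -> R) (x : V).

Definition sd f x := exists L : V -> R, sdiff f x L.

Lemma sd_near f g x : (\forall y \near x, f y = g y) -> sd f x -> sd g x.
Proof. by move=> fg [L /(sdiff_near fg)]; exists L. Qed.

Lemma sd_cst a x : sd (fun _ => a) x.
Proof. by exists (fun _ => 0); exact: sdiff_cst. Qed.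

Lemma sdD f g x : sd f x -> sd g x -> sd (fun y => f y + g y) x.
Proof. by move=> [L fL] [M gM]; eexists; exact: sdiffD fL gM. Qed.

Lemma sdM f g x : sd f x -> sd g x -> sd (fun y => f y * g y) x.
Proof. by move=> [L fL] [M gM]; eexists; exact: sdiffM fL gM. Qed.

Lemma sdZ a f x : sd f x -> sd (fun y => a * f y) x.
Proof. by move=> ?; apply: sdM => //; exact: sd_cst. Qed.

Lemma sdB f g x : sd f x -> sd g x -> sd (fun y => f y - g y) x.
Proof.
move=> fx gx; rewrite (_ : (fun y => _) = fun y => f y + -1 * g y).
  by apply: sdD => //; exact: sdZ.
by apply/funext => y; rewrite mulN1r.
Qed.

Lemma sd_pos2 f x : sd f x -> sd (fun y => pos2 (f y)) x.
Proof. by move=> [L fL]; eexists; exact: sdiff_comp fL (sdiff_pos2 _). Qed.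

Lemma sdV f x : f x != 0 -> sd f x -> sd (fun y => (f y)^-1) x.
Proof.
by move=> /sdiff_inv[c fc] [L fL]; eexists; exact: (sdiff_comp (g := fun s : R => s^-1) fL fc).
Qed.

Lemma sd_sqrt f x : 0 < f x -> sd f x -> sd (fun y => Num.sqrt (f y)) x.
Proof.
move=> /sdiff_sqrt[c fc] [L fL]; eexists.
exact: (sdiff_comp (g := fun s : R => Num.sqrt s) fL fc).
Qed.

Lemma liploc_continuous (W : normedModType R) (f : V -> W) x C :
  liploc f x C -> {for x, continuous f}.
Proof.
move=> [d d0 fC]; apply/cvgrPdist_le => e e0.
have C0 : 0 < `|C| + 1 by rewrite ltr_wpDl.
apply/nbhs_ballP; exists (Num.min d (e / (`|C| + 1))).
  by rewrite /= lt_min d0 divr_gt0.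
move=> y; rewrite -ball_normE /= lt_min => /andP[yd ye].
apply: le_trans (fC _ _ _ _) _ => //; first by rewrite subrr normr0.
  by rewrite distrC.
rewrite (@le_trans _ _ ((`|C| + 1) * `|x - y|))//.
  by rewrite ler_wpM2r// (le_trans (ler_norm _))// lerDl.
by rewrite mulrC -ler_pdivlMr// ltW.
Qed.

Lemma sd_continuous f x : sd f x -> {for x, continuous f}.
Proof. by move=> [L /sdiff_lip[C _ /liploc_continuous]]. Qed.

End StrictlyDifferentiable.

(** * Regularization of the squared distance *)

Section Hilbert.
Context {R : realType} {H : hilbertType R}.
Implicit Types (u v w x y : H) (T : set H).

Lemma hdotDr u v w : hdot u (v + w) = hdot u v + hdot u w.
Proof. by rewrite hdotC hdotDl !(hdotC u). Qed.

Lemma hdotZr a u v : hdot u (a *: v) = a * hdot u v.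
Proof. by rewrite hdotC hdotZl (hdotC u). Qed.

Lemma hdotNl u v : hdot (- u) v = - hdot u v.
Proof. by rewrite -scaleN1r hdotZl mulN1r. Qed.

Lemma hdotNr u v : hdot u (- v) = - hdot u v.
Proof. by rewrite hdotC hdotNl hdotC. Qed.

Lemma sqnormD u v : `|u + v| ^+ 2 = `|u| ^+ 2 + 2 * hdot u v + `|v| ^+ 2.
Proof. by rewrite -!hdotE !(hdotDl, hdotDr) (hdotC v u); ring. Qed.

Lemma sqnormB u v : `|u - v| ^+ 2 = `|u| ^+ 2 - 2 * hdot u v + `|v| ^+ 2.
Proof. by rewrite sqnormD hdotNr normrN; ring. Qed.

(** The norm comes with its triangle inequality, and squaring the latter for [v] and [- v] gives the
    two bounds. *)
Lemma cauchy_schwarz u v : `|hdot u v| <= `|u| * `|v|.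
Proof.
have sq (a b : H) : `|a + b| ^+ 2 <= (`|a| + `|b|) ^+ 2 :> R.
  by rewrite ler_pXn2r ?nnegrE ?addr_ge0// ler_normD.
have := sq u v; have := sq u (- v); rewrite normrN sqnormB sqnormD.
by rewrite ler_norml; move: (hdot u v) (`|u|) (`|v|) => t a b; nra.
Qed.

Lemma blin_hdot u : blin (fun v : H => hdot u v : R).
Proof.
split; last by exists `|u| => // v; exact: cauchy_schwarz.
by apply: linear_scalar => a v w; rewrite hdotDr hdotZr.
Qed.

Lemma sdiff_sqnorm x : sdiff (fun y : H => `|y| ^+ 2 : R) x (fun v => 2 * hdot x v).
Proof.
split; first split.
- by apply: linear_scalar => a v w; rewrite hdotDr hdotZr; ring.
- exists (2 * `|x|) => [|v]; first exact: mulr_ge0.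
  by rewrite normrM ger0_norm// -mulrA ler_wpM2l// cauchy_schwarz.
move=> e e0; exists (e / 2); first by lra.
move=> y z yx zx.
rewrite [X in `|X|](_ : _ = hdot (y - z) ((y - x) + (z - x))).
  rewrite (le_trans (cauchy_schwarz _ _))// mulrC ler_wpM2r//.
  by rewrite (le_trans (ler_normD _ _))//; lra.
rewrite -!hdotE !(hdotDl, hdotDr, hdotNl, hdotNr) (hdotC z y) (hdotC y x) (hdotC z x).
by move: (hdot y y) (hdot z z) (hdot x y) (hdot x z) (hdot y z) => a b c d e'; ring.
Qed.

Lemma sd_sqdist (c x : H) : sd (fun y : H => `|y - c| ^+ 2 : R) x.
Proof.
rewrite (_ : (fun y => _) = fun y => `|y| ^+ 2 - 2 * hdot c y + `|c| ^+ 2).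
  apply: sdD; last exact: sd_cst.
  apply: sdB; first by eexists; exact: sdiff_sqnorm.
  by apply: sdZ; eexists; apply: sdiff_blin; exact: blin_hdot.
by apply/funext => y; rewrite sqnormB hdotC.
Qed.

Lemma half_double (c : H) : 2^-1 *: (c + c) = c.
Proof.
rewrite -{1 2}[c]scale1r -scalerDl scalerA (_ : 2^-1 * (1 + 1) = 1) ?scale1r//.
by field.
Qed.

Section LasryLions.
Variables (T : set H) (T0 : T !=set0).

Definition sqdist y : R := inf [set `|y - c| ^+ 2 | c in T].

Lemma sqdist_has_inf y : has_inf [set `|y - c| ^+ 2 | c in T].
Proof.
by split; [have [c Tc] := T0; exists (`|y - c| ^+ 2), c|exists 0 => _ [c _ <-]; exact: sqr_ge0].
Qed.

Lemma sqdist_le y c : T c -> sqdist y <= `|y - c| ^+ 2.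
Proof. by move=> Tc; apply: ge_inf; [case: (sqdist_has_inf y)|exists c]. Qed.

Lemma sqdist_ge0 y : 0 <= sqdist y.
Proof.
by apply: lb_le_inf => [|_ [c _ <-]]; [case: (sqdist_has_inf y)|exact: sqr_ge0].
Qed.

Lemma sqdist_lt y a : sqdist y < a -> exists2 c, T c & `|y - c| ^+ 2 < a.
Proof.
by move=> /inf_lt[]; [case: (sqdist_has_inf y)|move=> _ [c Tc <-] ?; exists c].
Qed.

Lemma sqdistD x h : sqdist (x + h) <= 2 * sqdist x + 2 * `|h| ^+ 2.
Proof.
apply/ler_addgt0Pr => e e0.
have [|c Tc cx] := @sqdist_lt x (sqdist x + e / 2); first by lra.
have := sqdist_le (x + h) Tc; rewrite addrAC (sqnormD (x - c) h).
have : 0 <= `|x - c - h| ^+ 2 by exact: sqr_ge0.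
by rewrite (sqnormB (x - c)); lra.
Qed.

(** Semiconcavity: for a single centre [c] this is the parallelogram identity, and an infimum over
    [c] preserves the inequality. *)
Lemma sqdist_midpoint y0 y1 :
  sqdist y0 + sqdist y1 <= 2 * sqdist (2^-1 *: (y0 + y1)) + 2^-1 * `|y0 - y1| ^+ 2.
Proof.
apply/ler_addgt0Pr => e e0; set y := 2^-1 *: _.
have [|c Tc cy] := @sqdist_lt y (sqdist y + e / 2); first by lra.
have := sqdist_le y0 Tc; have := sqdist_le y1 Tc.
have yc : y - c = 2^-1 *: ((y0 - c) + (y1 - c)).
  rewrite addrACA -opprD scalerBr; congr (_ - _).
  by rewrite half_double.
have yy : y0 - y1 = (y0 - c) - (y1 - c) by rewrite opprB addrA subrK.
move: cy; rewrite yc yy normrZ exprMn normfV ger0_norm//.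
rewrite (sqnormD (y0 - c) (y1 - c)) (sqnormB (y0 - c)).
by lra.
Qed.

(* Lasry-Lions regularization: unlike the squared distance itself, its
   sup-convolution is C^1. *)
Definition supconv x : R := sup [set sqdist y - 2 * `|x - y| ^+ 2 | y in [set: H]].

(** The weight 2 beats the quadratic growth of the squared distance, so that the supremum is finite;
    the same 2 is the constant of [sqdistD]. *)
Lemma supconv_ub x y : sqdist y - 2 * `|x - y| ^+ 2 <= 2 * sqdist x.
Proof.
by have := sqdistD x (y - x); rewrite addrC subrK distrC; lra.
Qed.

Lemma supconv_has_sup x : has_sup [set sqdist y - 2 * `|x - y| ^+ 2 | y in [set: H]].
Proof.
split; first by exists (sqdist 0 - 2 * `|x - 0| ^+ 2), 0.
by exists (2 * sqdist x) => _ [y _ <-]; exact: supconv_ub.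
Qed.

Lemma supconv_lb x y : sqdist y - 2 * `|x - y| ^+ 2 <= supconv x.
Proof. by apply: sup_upper_bound; [exact: supconv_has_sup|exists y]. Qed.

Lemma supconv_le x : supconv x <= 2 * sqdist x.
Proof.
by apply: ge_sup => [|_ [y _ <-]]; [case: (supconv_has_sup x)|exact: supconv_ub].
Qed.

Lemma supconv_ge x : sqdist x <= supconv x.
Proof. by have := supconv_lb x x; rewrite subrr normr0 expr0n mulr0 subr0. Qed.

Lemma supconv_gt x a : a < supconv x -> exists y, a < sqdist y - 2 * `|x - y| ^+ 2.
Proof.
by move=> /sup_gt[]; [case: (supconv_has_sup x)|move=> _ [y _ <-] ?; exists y].
Qed.

(** A point [y] almost optimal for [x] competes for [x + u], and expanding -2|x + u - y|^2 yields
    the linear and the quadratic term. Almost optimal points suffice, as the supremum need not be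
    attained. *)
Lemma supconv_subgradient x e : 0 < e -> exists2 l : H -> R, blin l &
  forall u, supconv x - e + l u - 2 * `|u| ^+ 2 <= supconv (x + u).
Proof.
move=> e0; have [|y yP] := @supconv_gt x (supconv x - e); first by lra.
exists (fun u => -4 * hdot (x - y) u).
  have [lL [C C0 CL]] := blin_hdot (x - y); split.
    by apply: linear_scalar => a v w; rewrite (linPR lL); ring.
  exists (4 * C) => [|v]; first by rewrite mulr_ge0.
  by rewrite normrM normrN (ger0_norm (_ : 0 <= 4))// -mulrA ler_wpM2l.
move=> u; apply: le_trans (supconv_lb _ y).
by rewrite [x + u - y]addrAC (sqnormD (x - y) u); lra.
Qed.

(** The semiconcavity of [sqdist] survives the supremum: the midpoint of points almost optimal for
    [x + u] and [x - u] competes for [x]. *)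
Lemma supconv_second_difference x u :
  supconv (x + u) + supconv (x - u) <= 2 * supconv x + 4 * `|u| ^+ 2.
Proof.
apply/ler_addgt0Pr => e e0.
have [|y0 h0] := @supconv_gt (x + u) (supconv (x + u) - e / 2); first by lra.
have [|y1 h1] := @supconv_gt (x - u) (supconv (x - u) - e / 2); first by lra.
have h2 := supconv_lb x (2^-1 *: (y0 + y1)).
have h3 := sqdist_midpoint y0 y1.
have yy : y0 - y1 = (x - y1) - (x - y0).
  by rewrite opprB [RHS]addrC addrA subrK.
have xy : x - 2^-1 *: (y0 + y1) = 2^-1 *: ((x - y0) + (x - y1)).
  rewrite addrACA -opprD scalerBr; congr (_ - _).
  by rewrite half_double.
(* Once the parallelogram identities are expanded, half of this square is exactly the remaining
   slack. *)
have : 0 <= `|(x - y0) - (x - y1) + 4 *: u| ^+ 2 by exact: sqr_ge0.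
move: h0 h1 h2 h3; rewrite [x + u - y0]addrAC [x - u - y1]addrAC xy yy.
rewrite normrZ exprMn normfV ger0_norm//.
move: (x - y0) (x - y1) => a b.
rewrite !(sqnormB, sqnormD) hdotDl hdotNl !hdotZr normrZ ?(hdotC b a) ger0_norm//.
by rewrite exprMn; lra.
Qed.

Lemma sd_supconv x : sd supconv x.
Proof.
apply: (@sdiff_semiconvex_semiconcave _ _ _ 4) => // [y e e0|y u].
  have [l bl lP] := supconv_subgradient y e0; exists l => // u.
  by have := lP u; have := sqr_ge0 `|u|; lra.
exact: supconv_second_difference.
Qed.

(** An approximate subgradient at [z] is bounded by testing it in a unit step away from [z'], where
    the function is at most [4 * sqdist T z + 4]. This gives slope 10 up to [e], and the quadratic
    term adds 2 for steps of length at most 1. *)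
Lemma supconv_lip x y : supconv x <= 1 -> supconv y <= 1 -> `|x - y| <= 1 ->
  `|supconv x - supconv y| <= 12 * `|x - y|.
Proof.
suff K z z' : supconv z <= 1 -> `|z - z'| <= 1 ->
    supconv z - supconv z' <= 12 * `|z - z'|.
  move=> x1 y1 xy; have h1 := K _ _ x1 xy.
  have := K y x y1; rewrite distrC => /(_ xy).
  by rewrite ler_norml; lra.
move=> z1 zz1; have [->|zz'] := eqVneq z z'; first by rewrite !subrr normr0 mulr0.
pose h := z' - z; have h0 : 0 < `|h| by rewrite normr_gt0 subr_eq0 eq_sym.
have z'E : z' = z + h by rewrite /h addrC subrK.
have nh : `|z - z'| = `|h| by rewrite distrC.
rewrite nh in zz1 *; rewrite -subr_le0.
apply: (@le0_forall_eps _ _ (1 + `|h|)) => e e0.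
have [l [ll _] lP] := supconv_subgradient z e0.
have := lP (- (`|h|^-1) *: h); rewrite (linZR ll) normrZ normrN normfV normr_id.
rewrite mulVf ?gt_eqF// expr1n => h1.
have := supconv_le (z + - (`|h|^-1) *: h).
have := sqdistD z (- (`|h|^-1) *: h); rewrite normrZ normrN normfV normr_id.
rewrite mulVf ?gt_eqF// expr1n => h2 h3.
have := supconv_ge z; have := sqdist_ge0 z => h4 h5.
have l1 : - (`|h|^-1 * l h) <= 10 + e by lra.
have l2 : - l h <= (10 + e) * `|h|.
  rewrite (_ : - l h = - (`|h|^-1 * l h) * `|h|); last by field; rewrite gt_eqF.
  by rewrite ler_wpM2r.
have := lP h; rewrite -z'E => h6.
have : `|h| ^+ 2 <= `|h| by rewrite expr2 ler_piMr.
by move: l2 h6; lra.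
Qed.

End LasryLions.

(** As [supconv] lies between [sqdist] and its double, it vanishes on [T], and where it is below d^2
    the distance to [T] is below [d]. The constant 24 is 12 from [supconv_lip] times 2 from
    [pos2_lip]; it depends neither on [T] nor on [d]. *)
Lemma smooth_bump T (d : R) : T !=set0 -> 0 < d < 1 ->
  exists w : H -> R, [/\ forall x, sd w x, forall x, 0 <= w x <= 1,
    forall x, T x -> 0 < w x,
    forall x, w x != 0 -> exists2 t, T t & `|x - t| < d &
    forall x, \forall y \near x, `|w y - w x| <= 24 * `|y - x|].
Proof.
move=> T0 /andP[d0 d1].
have d21 : d ^+ 2 < 1 by rewrite expr_lt1// ltW.
have d20 : 0 < d ^+ 2 by rewrite exprn_gt0.
have v0 x : 0 <= supconv T x by exact: le_trans (sqdist_ge0 T0 x) (supconv_ge T0 x).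
have vc x : {for x, continuous (supconv T)} by apply: sd_continuous; exact: sd_supconv.
exists (fun x => pos2 (d ^+ 2 - supconv T x)); split.
- by move=> x; apply: sd_pos2; apply: sdB; [exact: sd_cst|exact: sd_supconv].
- by move=> x; rewrite pos2_ge0 pos2_le1//; have := v0 x; lra.
- move=> x Tx; apply: pos2_gt0; rewrite subr_gt0 (le_lt_trans (supconv_le T0 x))//.
  have : sqdist T x <= 0 by have := sqdist_le T0 x Tx; rewrite subrr normr0 expr0n.
  by lra.
- move=> x wx; have vd : supconv T x < d ^+ 2.
    by rewrite ltNge; apply: contra wx => vd; rewrite pos2_le0// subr_le0.
  have [t Tt xt] := sqdist_lt T0 (le_lt_trans (supconv_ge T0 x) vd); exists t => //.
  by move: xt; rewrite ltr_pXn2r// nnegrE// ltW.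
(* Where [supconv] is at least 1 the bump vanishes nearby because d^2 < 1; elsewhere [supconv_lip]
   applies. *)
- move=> x; have [v1|v1] := ltP (supconv T x) 1; last first.
    have vd := lt_le_trans d21 v1.
    apply: filterS (cvgr_gt _ (vc x) _ vd) => y yd.
    by rewrite !pos2_le0 ?subrr ?normr0 ?mulr_ge0//; lra.
  have near1 : \forall y \near x, `|y - x| <= 1.
    apply/nbhs_ballP; exists 1 => //= y; rewrite -ball_normE /= distrC; exact: ltW.
  apply: filterS2 near1 (cvgr_lt _ (vc x) _ v1) => y y1 vy.
  have vl := supconv_lip T0 (ltW vy) (ltW v1) y1.
  apply: le_trans (pos2_lip _ _) _; [by have := v0 y; lra|by have := v0 x; lra|].
  rewrite (_ : d ^+ 2 - supconv T y - _ = supconv T x - supconv T y); last by ring.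
  by rewrite distrC; lra.
Qed.

End Hilbert.

Lemma segment_ball (R : realType) (V : normedModType R) (x y z : V) (d t : R) :
  `|z - x| < d -> `|y - x| < d -> 0 <= t <= 1 -> `|z + t *: (y - z) - x| < d.
Proof.
move=> zx yx /andP[t0 t1].
rewrite (_ : _ - x = (1 - t) *: (z - x) + t *: (y - x)); last first.
  rewrite scalerBl scale1r -[RHS]addrA [- _ + _]addrC -scalerBr.
  by rewrite opprB addrA subrK [LHS]addrAC.
rewrite (le_lt_trans (ler_normD _ _))// (normrZ (1 - t)) (normrZ t).
rewrite (ger0_norm t0) ger0_norm ?subr_ge0//.
have [->|t00] := eqVneq t 0; first by rewrite subr0 mul1r mul0r addr0.
have t0' : 0 < t by rewrite lt_neqAle eq_sym t00.
have : t * `|y - x| < t * d by rewrite ltr_pM2l.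
have : (1 - t) * `|z - x| <= (1 - t) * d by rewrite ler_wpM2l ?subr_ge0// ltW.
by lra.
Qed.

(** * Strict differentiability, Fréchet differentiability and C^1 maps *)

Section Bridge.
Context {R : realType} {V W : normedModType R}.
Implicit Types (f : V -> W) (x y : V) (L : V -> W) (D : set V).

Lemma blin_continuous L : blin L -> continuous L.
Proof.
move=> [lL [C C0 LC]] x; apply: (@liploc_continuous _ _ _ L x C).
by exists 1 => // y z _ _; rewrite -(linB lL).
Qed.

Lemma blin_clin L : blin L -> exists F : clin V W, F = L :> (V -> W).
Proof.
move=> bL; have h : L \in @clin_pred _ V W.
  by rewrite inE; split; [case: bL|exact: blin_continuous].
by exists (CLin h).
Qed.

Lemma clin_blin (F : clin V W) : blin F.
Proof.
split; first exact: clin_linear.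
by exists (opnorm F); [exact: opnorm_ge0|exact: opnormP].
Qed.

Lemma sdiff_diff f x L : sdiff f x L ->
  differentiable f x /\ 'd f x = L :> (V -> W).
Proof.
move=> [bL fL]; have [F FL] := blin_clin bL.
have gE : f \o shift x = cst (f x) + F +o_ 0 id.
  apply/eqaddoP => e e0; have [d d0 fd] := fL e e0.
  apply/nbhs_ballP; exists d => //= y; rewrite -ball_normE /= sub0r normrN => yd.
  have := fd (y + x) x; rewrite addrK subrr normr0 => /(_ yd d0).
  rewrite [((f \o shift x) - _) y](_ : _ = f (y + x) - f x - L y)//.
  by rewrite -FL -[LHS]/(f (y + x) - (f x + F y)) opprD addrA.
have cF : continuous F by exact: clin_continuous.
have dgE := diff_unique cF gE.
split; last by rewrite dgE; exact: FL.
by apply/diff_locallyP; rewrite dgE; split.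
Qed.

Lemma diff_blin f x : differentiable f x -> blin ('d f x).
Proof.
move=> df; split; first by move=> a u v; rewrite linearP.
have c0 : {for 0, continuous ('d f x)} by exact: diff_continuous.
have /linear_boundedP := continuous_linear_bounded 0 c0.
by case/pinfty_ex_gt0 => C C0 fC; exists C; [exact: ltW|exact: fC].
Qed.

Lemma differentiable_slope f x e : differentiable f x -> 0 < e ->
  \forall y \near x, `|f y - f x - 'd f x (y - x)| <= e * `|y - x|.
Proof.
move=> df e0; have /eqaddoP/(_ e e0)/nbhs_ballP[d /= d0 fd] := diff_locally df.
apply/nbhs_ballP; exists d => //= y; rewrite -ball_normE /= distrC => yd.
have := fd (y - x); rewrite -ball_normE /= sub0r normrN => /(_ yd).
rewrite [((f \o shift x) - _) _](_ : _ = f y - f x - 'd f x (y - x))//.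
by rewrite -[LHS]/(f (y - x + x) - (f x + 'd f x (y - x))) subrK opprD addrA.
Qed.

(** The estimate around [x] also holds around the nearby point [y], so both linear maps approximate
    the same increments there. This is how strict differentiability on an open set yields continuity
    of the differential. *)
Lemma sapprox_sdiff_close f x y e d L M : 0 < d ->
  (forall y z, `|y - x| < d -> `|z - x| < d ->
    `|f y - f z - L (y - z)| <= e * `|y - z|) ->
  linear L -> sdiff f y M -> `|y - x| < d -> forall v, `|M v - L v| <= e * `|v|.
Proof.
move=> d0 fL lL [[lM _] fM] yd v; rewrite -subr_le0.
apply: (@le0_forall_eps _ _ `|v|) => e' e'0.
have [d' d'0 fM'] := fM e' e'0.
have [->|v0] := eqVneq v 0.
  by rewrite (lin0 lM) (lin0 lL) !normr0 subrr normr0; lra.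
have nv : 0 < `|v| by rewrite normr_gt0.
pose m := Num.min d' (d - `|y - x|); have m0 : 0 < m by rewrite lt_min d'0 subr_gt0.
pose t := m / 2 / `|v|; have t0 : 0 < t by rewrite !divr_gt0.
have tv : `|t *: v| < m by rewrite normrZ gtr0_norm// divfK ?gt_eqF//; lra.
have := fM' (t *: v + y) y; rewrite addrK subrr normr0 => /(_ _ d'0) h1.
have := fL (t *: v + y) y; rewrite addrK -addrA => /(_ _ yd) h2.
have {}h1 : `|f (t *: v + y) - f y - M (t *: v)| <= e' * `|t *: v|.
  by apply: h1; rewrite (lt_le_trans tv)// ge_min lexx.
have {}h2 : `|f (t *: v + y) - f y - L (t *: v)| <= e * `|t *: v|.
  apply: h2; rewrite (le_lt_trans (ler_normD _ _))// -ltrBrDr (lt_le_trans tv)//.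
  by rewrite ge_min lexx orbT.
have : `|M (t *: v) - L (t *: v)| <= (e + e') * `|t *: v|.
  rewrite (_ : M _ - L _ = (f (t *: v + y) - f y - L (t *: v)) -
    (f (t *: v + y) - f y - M (t *: v))).
    by rewrite (le_trans (ler_normB _ _))//; lra.
  by rewrite opprB [RHS]addrC addrA subrK.
rewrite (linZ lM) (linZ lL) -scalerBr !(normrZ t) (gtr0_norm t0).
by rewrite mulrCA ler_pM2l//; lra.
Qed.

Lemma sdiff_Ck1 D f : open D -> (forall x, D x -> exists L, sdiff f x L) ->
  Ck_on 1 D f.
Proof.
move=> oD Df.
have /choice[df dfP] x : exists F : clin V W, D x -> sdiff f x F.
  have [/Df[L fL]|nDx] := pselect (D x); last by exists 0.
  by have [F FL] := blin_clin fL.1; exists F => _; rewrite FL.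
exists df; split=> x; rewrite inE => Dx.
  exact: sdiff_diff (dfP _ Dx).
apply/cvgrPdist_le => e e0.
have [bL /(_ e e0)[d d0 fd]] := dfP _ Dx.
have nD : nbhs x D by exact: open_nbhs_nbhs.
have nd : \forall y \near x, `|y - x| < d.
  by apply/nbhs_ballP; exists d => //= y; rewrite -ball_normE /= distrC.
apply: filterS2 nD nd => y Dy yd; rewrite distrC.
apply: opnorm_le; first exact: ltW.
exact: sapprox_sdiff_close d0 fd bL.1 (dfP _ Dy) yd.
Qed.

(** The mean value inequality on segments is applied to [f] minus its differential at [x], whose own
    differential is at most e/2 in norm near [x]. *)
Lemma Ck1_sdiff D f x : open D -> D x -> Ck_on 1 D f -> sdiff f x ('d f x).
Proof.
move=> oD Dx [df [ddf cdf]]; have xD : x \in D by rewrite inE.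
have [fx fxE] := ddf x xD.
have bL := diff_blin fx; split=> // e e0.
have e20 : 0 < e / 2 by lra.
have := cdf x xD; move/cvgrPdist_le => /(_ _ e20) nF.
have nD : nbhs x D by exact: open_nbhs_nbhs.
have /nbhs_ballP[d /= d0 dP] : nbhs x [set y | `|df x - df y| <= e / 2 /\ D y].
  by apply: filterS2 nF nD.
exists d => // y z yx zx.
have [->|yz] := eqVneq y z.
  by rewrite !subrr (lin0 bL.1) subrr !normr0 mulr0.
pose h := y - z; have nh : 0 < `|h| by rewrite normr_gt0 subr_eq0.
pose q (t : R) := z + t *: h.
pose psi t := f (q t) - 'd f x (q t).
have qd (t : R) : 0 <= t <= 1 -> `|q t - x| < d by exact: segment_ball.
have slope (t : R) : 0 <= t <= 1 -> forall K' : R, e / 2 * `|h| < K' ->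
    \forall s \near t, 0 <= s <= 1 -> `|psi s - psi t| <= K' * `|s - t|.
  move=> t01 K' K'h.
  have Bq : ball x d (q t) by rewrite -ball_normE /= distrC qd.
  have [F1 Dq] := dP _ Bq.
  have qD : q t \in D by rewrite inE.
  have [dq dqE] := ddf _ qD.
  (* The slack of [K'] is spent on the first order error of [f] at [q t]. *)
  pose e' := (K' - e / 2 * `|h|) / `|h|.
  have e'0 : 0 < e' by rewrite divr_gt0// subr_gt0.
  have qc : {for t, continuous q}.
    by apply: cvgD; [exact: cvg_cst|apply: cvgZr_tmp; exact: cvg_id].
  have nq : \forall s \near t,
      `|f (q s) - f (q t) - 'd f (q t) (q s - q t)| <= e' * `|q s - q t|.
    exact: (qc _ (differentiable_slope dq e'0)).
  apply: filterS nq => s fs _.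
  have qq : q s - q t = (s - t) *: h by rewrite /q opprD addrACA subrr add0r scalerBl.
  have F2 : `|'d f (q t) (q s - q t) - 'd f x (q s - q t)| <= e / 2 * `|q s - q t|.
    rewrite dqE fxE -normrN opprB.
    by rewrite (le_trans (opnormP (df x - df (q t)) _))// ler_wpM2r.
  rewrite (_ : psi s - psi t = (f (q s) - f (q t) - 'd f (q t) (q s - q t))
     + ('d f (q t) (q s - q t) - 'd f x (q s - q t))); last first.
    have E (a b c d' m : W) : a - c - (b - d') = (a - b - m) + (m - (c - d')).
      by rewrite addrA subrK !opprB addrACA [RHS]addrACA [- c - b]addrC.
    by rewrite (linB bL.1); exact: E.
  rewrite (le_trans (ler_normD _ _))//.
  have : (e' + e / 2) * `|q s - q t| = K' * `|s - t|.
    by rewrite qq normrZ /e'; field; rewrite gt_eqF.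
  by lra.
have := slope_bound ler01 slope; rewrite /psi /q scale1r scale0r addr0 subr0 mulr1.
have -> : z + h = y by rewrite /h addrC subrK.
move=> H1.
rewrite (_ : f y - f z - 'd f x (y - z) = f y - 'd f x y - (f z - 'd f x z)).
  by rewrite (le_trans H1)// -/h ler_wpM2r//; lra.
by rewrite (linB bL.1) !opprB addrACA [RHS]addrACA [- f z + _]addrC.
Qed.

End Bridge.

(** * Charts of a Riemannian manifold *)

Section Charts.
Context {R : realType} {H : hilbertType R} {M : manifold H}.
Implicit Types (p q x y : M).

(** Since [chart_at] depends on its base point, facts about a chart at [q] reach the rest of its
    domain by changing the base point. *)
Definition rechart q (k : chart_at q) x (kx : chart_dom k x) : chart_at x :=
  ChartAt (chart_at_atlas k) kx.

Lemma near_dom q (k : chart_at q) : \forall y \near q, chart_dom k y.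
Proof. by apply: open_nbhs_nbhs; split; [exact: chart_dom_open|exact: chart_at_dom]. Qed.

Lemma chart_continuous q (k : chart_at q) : {for q, continuous k}.
Proof. by apply: chart_map_continuous; rewrite inE; exact: chart_at_dom. Qed.

Lemma near_chart_img q (k : chart_at q) : \forall y \near k q, chart_img k y.
Proof.
apply: open_nbhs_nbhs; split; first exact: chart_img_open.
by exists q => //; exact: chart_at_dom.
Qed.

Lemma chart_domK q (k : chart_at q) x : chart_dom k x -> chart_inv k (k x) = x.
Proof. by move=> kx; rewrite chart_mapK ?inE. Qed.

Lemma chart_imgP q (k : chart_at q) (y : H) : chart_img k y ->
  chart_dom k (chart_inv k y) /\ k (chart_inv k y) = y.
Proof. by move=> [x kx <-]; rewrite chart_domK. Qed.

Lemma open_overlap q (h k : chart_at q) : open (h @` (chart_dom h `&` chart_dom k)).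
Proof.
rewrite openE => _ [x [hx kx] <-].
pose h' := rechart hx; pose k' := rechart kx.
have n1 : \forall y \near h' x, chart_img h' y by exact: near_chart_img.
have n2 : \forall y \near h' x, chart_dom k (chart_inv h' y).
  exact: (@chart_inv_cvg _ _ _ _ h' _ (near_dom k')).
apply: filterS2 n1 n2 => _ [y hy <-] ky.
by exists y => //; split=> //; rewrite (chart_domK (k := h')) in ky.
Qed.

Lemma sdiff_transition q (h k : chart_at q) :
  sdiff (transition h k) (h q) ('d (transition h k) (h q)).
Proof.
have [/(_ 1%N) hk _] := atlas_compatible (chart_at_atlas h) (chart_at_atlas k).
apply: Ck1_sdiff hk; first exact: open_overlap.
by exists q => //; split; exact: chart_at_dom.
Qed.

End Charts.

(** * Uniform metric bounds and short segments *)

Section RiemannianMetric.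
Context {R : realType} {H : hilbertType R} {M : manifold H}.
Variable g : riemannian_metric M.
Implicit Types (p q x : M).

Definition tnorm x (v : tangent x) : R := Num.sqrt (metric g v v).

Lemma metric_ge0 x (v : tangent x) : 0 <= metric g v v.
Proof.
have [->|v0] := eqVneq v 0; last by rewrite ltW// metric_gt0.
by rewrite -(scale0r (0 : tangent x)) metricZl mul0r.
Qed.

(** The comparison of norms, made uniform over a chart ball. The chart [l] is [k] seen from [x]; the
    equation between the underlying charts avoids a cast from [chart_at q] to [chart_at x]. *)
Definition metric_bounded q (k : chart_at q) (rho c C : R) :=
  [/\ 0 < rho, 0 < c, 0 < C,
      forall y, `|y - k q| < rho -> chart_img k y &
      forall x (l : chart_at x), l = k :> chart H M -> `|k x - k q| < rho ->
        forall v : tangent x, c * `|dchart l v| <= tnorm v <= C * `|dchart l v|].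

(** By continuity, the coordinate form [G] moves by at most (3/4) c^2 near [k q]; this leaves c^2/4
    = (c/2)^2 from below and at most (C + c)^2 from above. *)
Lemma metric_bounds q (k : chart_at q) : exists rho c C, metric_bounded k rho c C.
Proof.
have [c [C [c0 C0 cC]]] := metric_equivalent g k.
have [G G1 GE] := metric_smooth g (chart_at_atlas k).
have qk : k q \in chart_img k by rewrite inE; exists q => //; exact: chart_at_dom.
have c20 : 0 < 3 / 4 * c ^+ 2 by have := exprn_gt0 2 c0; lra.
have Gc : \forall y \near k q, `|G (k q) - G y| <= 3 / 4 * c ^+ 2.
  by have := (G1 0%N) _ qk; move/cvgrPdist_le; apply.
have /nbhs_ballP[rho /= rho0 rhoP] :
    nbhs (k q) [set y | `|G (k q) - G y| <= 3 / 4 * c ^+ 2 /\ chart_img k y].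
  by apply: filterS2 Gc (near_chart_img k).
have rP y : `|y - k q| < rho -> `|G (k q) - G y| <= 3 / 4 * c ^+ 2 /\ chart_img k y.
  by move=> yq; apply: rhoP; rewrite -ball_normE /= distrC.
exists rho, (c / 2), (C + c); split; [by []|lra|lra|by move=> y /rP[]|].
move=> x l lk xq v; set w := dchart l v.
have [Gx _] := rP _ xq.
have E1 : metric g v v = G (k x) w w by rewrite (GE x l)// /w dchartK.
have := cC (dchart_inv k w); rewrite dchart_invK.
have -> : Num.sqrt (metric g (dchart_inv k w) (dchart_inv k w)) = Num.sqrt (G (k q) w w).
  by rewrite (GE q k).
move=> /andP[h1 h2].
have Gq0 : 0 <= G (k q) w w by rewrite (GE q k)//; exact: metric_ge0.
have d1 : `|G (k q) w w - G (k x) w w| <= 3 / 4 * c ^+ 2 * `|w| ^+ 2.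
  have o1 : `|G (k q) w w - G (k x) w w| <= opnorm ((G (k q) - G (k x)) w) * `|w|.
    exact: (opnormP ((G (k q) - G (k x)) w) w).
  apply: le_trans o1 _; rewrite expr2 mulrA ler_wpM2r//.
  have o2 : opnorm ((G (k q) - G (k x)) w) <= opnorm (G (k q) - G (k x)) * `|w|.
    exact: (opnormP (G (k q) - G (k x)) w).
  by apply: le_trans o2 _; rewrite ler_wpM2r.
have g1 : (c * `|w|) ^+ 2 <= G (k q) w w.
  by rewrite -(sqr_sqrtr Gq0) ler_pXn2r// nnegrE ?sqrtr_ge0// mulr_ge0// ltW.
have g2 : G (k q) w w <= (C * `|w|) ^+ 2.
  by rewrite -(sqr_sqrtr Gq0) ler_pXn2r// nnegrE ?sqrtr_ge0// mulr_ge0// ltW.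
have m0 := metric_ge0 v.
rewrite /tnorm E1; rewrite E1 in m0; move: d1 g1 g2 m0.
rewrite !exprMn; move: (G (k q) w w : R) (G (k x) w w : R) => A B d1 g1 g2 m0.
have c2 : 0 <= c ^+ 2 * `|w| ^+ 2 by rewrite mulr_ge0// sqr_ge0.
have cc2 : 0 <= c * C * `|w| ^+ 2 by rewrite mulr_ge0 ?sqr_ge0// mulr_ge0// ltW.
apply/andP; split.
  rewrite -[leLHS]ger0_norm; last by rewrite mulr_ge0// divr_ge0// ltW.
  rewrite -sqrtr_sqr ler_wsqrtr// exprMn exprMn exprVn.
  by move: d1; rewrite ler_norml; lra.
rewrite -[leRHS]ger0_norm; last by rewrite mulr_ge0// addr_ge0// ltW.
rewrite -sqrtr_sqr ler_wsqrtr// exprMn sqrrD.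
by move: d1; rewrite ler_norml; lra.
Qed.

(** Both charts are compared with the same intrinsic norm, so the differential of the transition map
    has norm at most [L / c]. *)
Lemma transition_slope x (k h : chart_at x) (c L L' : R) : 0 < c ->
  (forall v : tangent x, c * `|dchart h v| <= tnorm v) ->
  (forall v : tangent x, tnorm v <= L * `|dchart k v|) -> L / c < L' ->
  \forall y \near x, `|h y - h x| <= L' * `|k y - k x|.
Proof.
move=> c0 hc kL LL'.
have D w : `|'d (transition k h) (k x) w| <= L / c * `|w|.
  have := hc (dchart_inv k w); have := kL (dchart_inv k w).
  rewrite dchart_invK => h1 h2; rewrite mulrAC ler_pdivlMr// mulrC.
  exact: le_trans h2 h1.
have dt := transition_differentiable k h.
have e0 : 0 < L' - L / c by rewrite subr_gt0.
have kc : {for x, continuous k} by exact: chart_continuous.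
have n1' : \forall y \near x, `|transition k h (k y) - transition k h (k x) -
    'd (transition k h) (k x) (k y - k x)| <= (L' - L / c) * `|k y - k x|.
  exact: (kc _ (differentiable_slope dt e0)).
apply: filterS2 n1' (near_dom k) => y; rewrite /transition /= => h1 ky.
rewrite !chart_domK// in h1; last exact: chart_at_dom.
have := ler_normD (h y - h x - 'd (h \o chart_inv k) (k x) (k y - k x))
  ('d (h \o chart_inv k) (k x) (k y - k x)).
by rewrite subrK; have := D (k y - k x); lra.
Qed.

Definition segment q (k : chart_at q) (a b : H) (t : R) : M :=
  chart_inv k (a + t *: (b - a)).

Lemma segment_continuous q (k : chart_at q) a b t :
  chart_img k (a + t *: (b - a)) -> {for t, continuous (segment k a b)}.
Proof.
move=> kt; apply: continuous_comp; last by apply: chart_inv_continuous; rewrite inE.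
by apply: cvgD; [exact: cvg_cst|apply: cvgZr_tmp; exact: cvg_id].
Qed.

Lemma exists_slope (A B K : R) : 0 <= B -> A * B < K -> exists2 L, A < L & L * B <= K.
Proof.
rewrite le_eqVlt => /orP[/eqP<-|B0] AK.
  by exists (A + 1); [lra|rewrite mulr0 ltW//; move: AK; rewrite mulr0].
by exists (K / B); rewrite ?ltr_pdivlMr// divfK// gt_eqF.
Qed.

(* If the path stays in the chart ball up to time [t], completeness gives a
   limit in the image of the chart, and separation identifies the corresponding
   point with the value of the path at [t]. *)
Lemma segment_stays p (h : chart_at p) rho c C1 q (k : chart_at q) sigma c' C r K a b :
  metric_bounded h rho c C1 -> metric_bounded k sigma c' C ->
  `|a - k q| < sigma -> `|b - k q| < sigma ->
  chart_dom h (segment k a b 0) -> `|h (segment k a b 0) - h p| <= r ->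
  C / c * `|b - a| < K -> r + K < rho ->
  forall t, 0 <= t <= 1 -> chart_dom h (segment k a b t) /\
    `|h (segment k a b t) - h (segment k a b 0)| <= K * t.
Proof.
move=> [rho0 c0 C10 hB hN] [sigma0 c'0 C0 kB kN] aq bq.
set gam := segment k a b => h0 hr CK rK.
have img t : 0 <= t <= 1 -> chart_img k (a + t *: (b - a)).
  by move=> t01; apply: kB; exact: segment_ball.
have kgam t : 0 <= t <= 1 -> chart_dom k (gam t) /\ k (gam t) = a + t *: (b - a).
  by move=> /img /chart_imgP.
have gamc t : 0 <= t <= 1 -> {for t, continuous gam}.
  by move=> /img /segment_continuous.
have [L LC LK] := exists_slope (normr_ge0 (b - a)) CK.
have K0 : 0 < K.
  by apply: le_lt_trans CK; rewrite mulr_ge0// divr_ge0// ltW.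
(* Because [r + K < rho], the path stays in the ball where the metric bounds hold, and those bounds
   keep its speed in the chart [h] below [K]. *)
have hball t : 0 <= t <= 1 -> `|h (gam t) - h (gam 0)| <= K * t -> `|h (gam t) - h p| < rho.
  move=> /andP[t0 t1] ht; rewrite (le_lt_trans _ rK)//.
  rewrite (le_trans (ler_distD (h (gam 0)) _ _))//.
  have : K * t <= K by rewrite ler_piMr// ltW.
  by lra.
have slope t : 0 <= t <= 1 -> chart_dom h (gam t) ->
    `|h (gam t) - h (gam 0)| <= K * t ->
    \forall s \near t, 0 <= s <= 1 ->
       chart_dom h (gam s) /\ `|h (gam s) - h (gam t)| <= K * `|s - t|.
  move=> t01 ht htb.
  have [kt ktE] := kgam t t01.
  pose k' := rechart kt; pose h' := rechart ht.
  have Hc (v : tangent (gam t)) : c * `|dchart h' v| <= tnorm v.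
    by have /andP[] := hN _ h' erefl (hball t t01 htb) v.
  have KC (v : tangent (gam t)) : tnorm v <= C * `|dchart k' v|.
    have ktq : `|k (gam t) - k q| < sigma by rewrite ktE; exact: segment_ball.
    by have /andP[] := kN _ k' erefl ktq v.
  have n1 := transition_slope c0 Hc KC LC.
  have n2 := near_dom h'.
  have n3 : \forall s \near t, chart_dom h (gam s) /\
      `|h (gam s) - h (gam t)| <= L * `|k (gam s) - k (gam t)|.
    exact: (gamc t t01 _ (filterI n2 n1)).
  apply: filterS n3 => s [hs hst] s01; split=> //.
  apply: le_trans hst _; rewrite ktE (kgam s s01).2 opprD addrACA subrr add0r -scalerBl.
  by rewrite normrZ mulrCA mulrC ler_wpM2r.
apply: real_induction.
- by rewrite subrr normr0 mulr0.
- move=> t /andP[t0 t1] IH.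
  have t01 : 0 <= t <= 1 by rewrite t0 ltW.
  have [ht htb] := IH t ltac:(by rewrite t0 lexx).
  have /nbhs_ballP[d /= d0 dP] := slope t t01 ht htb.
  exists (Num.min d (1 - t)); first by rewrite lt_min d0 subr_gt0.
  move=> s /andP[ts]; rewrite -ltrBlDl lt_min => /andP[sd s1].
  have sB : ball t d s by rewrite -ball_normE /= distrC ger0_norm; lra.
  have [|hs hst] := dP s sB; first by apply/andP; split; lra.
  split=> //; rewrite (le_trans (ler_distD (h (gam t)) _ _))//.
  by move: hst htb; rewrite gtr0_norm; lra.
- move=> t /andP[t0 t1] IH.
  have t01 : 0 <= t <= 1 by rewrite t1 ltW.
  (* Before time [t] the path is [K]-Lipschitz in the chart [h], hence Cauchy from the left at
     [t]. *)
  have lip s s' : 0 <= s -> s <= s' -> s' < t -> `|h (gam s') - h (gam s)| <= K * (s' - s).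
    move=> s0 ss' s't; apply: (@slope_bound _ _ (h \o gam) _ _ _ ss') => u /andP[su us'] K' KK'.
    have [|hu hub] := IH u; first by apply/andP; split; lra.
    have u01 : 0 <= u <= 1 by apply/andP; split; lra.
    apply: filterS (slope u u01 hu hub) => w hw /andP[sw ws'].
    have [|_ ] := hw; first by apply/andP; split; lra.
    by move=> /le_trans; apply; rewrite ler_wpM2r// ltW.
  have IHb s : 0 <= s < t -> chart_dom h (gam s) /\ `|h (gam s) - h p| < rho.
    move=> /[dup] /andP[s0 st] /IH[hs hsb]; split=> //; apply: hball => //.
    by apply/andP; split; lra.
  pose F := h (gam s) @[s --> t^'-].
  have nearF (P : set R) (s0 : R) : s0 < t -> (forall s, s0 < s < t -> P s) ->
      \forall s \near t^'-, P s.
    move=> s0t sP; near=> s; apply: sP; apply/andP; split; last by [].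
    by near: s; exact: nbhs_left_gt.
  have cF : cvg F.
    apply: cauchy_cvg; apply: cauchy_exP => e e0.
    pose s0 := Num.max 0 (t - e / 2 / K).
    have eK0 : 0 < e / 2 / K by rewrite !divr_gt0.
    have s0t : s0 < t by rewrite gt_max t0 /=; lra.
    have s00 : 0 <= s0 by rewrite le_max lexx.
    exists (h (gam s0)); apply: (nearF _ s0) => // s /andP[s0s st].
    rewrite -ball_normE /= distrC (le_lt_trans (lip s0 s s00 (ltW s0s) st))//.
    have : t - e / 2 / K <= s0 by rewrite le_max lexx orbT.
    move=> ts0; apply: (@le_lt_trans _ _ (K * (e / 2 / K))).
      by rewrite ler_pM2l//; lra.
    by rewrite mulrC divfK ?gt_eqF//; lra.
  set z := lim F in cF; have Fz : h (gam s) @[s --> t^'-] --> z by exact: cF.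
  have zb : `|z - h (gam 0)| <= K * t.
    have nz : `|h (gam s) - h (gam 0)| @[s --> t^'-] --> `|z - h (gam 0)|.
      by apply: cvg_norm; apply: cvgB => //; exact: cvg_cst.
    rewrite -(cvg_lim _ nz)//; apply: limr_le; first by apply/cvg_ex; eexists; exact: nz.
    apply: (nearF _ 0) => // s /andP[s0 st].
    have [|_ /le_trans] := IH s; first by rewrite (ltW s0).
    by apply; rewrite ler_pM2l// ltW.
  have zr : `|z - h p| < rho.
    rewrite (le_lt_trans _ rK)// (le_trans (ler_distD (h (gam 0)) _ _))//.
    have : K * t <= K by rewrite ler_piMr// ltW.
    by lra.
  have [hx hxz] := chart_imgP (hB z zr); set x' := chart_inv h z in hx hxz.
  have iz : {for z, continuous (chart_inv h)}.
    by apply: chart_inv_continuous; rewrite inE; exact: hB.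
  have c1 : chart_inv h (h (gam s)) @[s --> t^'-] --> x'.
    exact: (cvg_comp _ _ Fz iz).
  have c2 : gam s @[s --> t^'-] --> x'.
    apply: cvg_trans c1; apply: near_eq_cvg; apply: (nearF _ 0) => // s /andP[s0 st].
    by rewrite chart_domK//; have [] := IHb s; rewrite ?(ltW s0).
  have c3 : gam s @[s --> t^'-] --> gam t.
    by apply: cvg_at_left_filter; exact: gamc.
  have -> : gam t = x' by exact: (@cvg_unique _ (@manifold_hausdorff _ _ M) _ _ (gam t) x' c3 c2).
  by rewrite hxz.
Unshelve. all: by end_near. Qed.

End RiemannianMetric.

(** * C^1 functions on the manifold *)

Section Msd.
Context {R : realType} {H : hilbertType R} {M : manifold H}.
Implicit Types (x : M) (phi psi : M -> R).

Definition msd phi x := forall k : chart_at x, sd (phi \o chart_inv k) (k x).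

Lemma msd_chart phi x (k : chart_at x) : sd (phi \o chart_inv k) (k x) -> msd phi x.
Proof.
move=> [L kL] l.
have Ek : transition l k (l x) = k x by rewrite /transition/= chart_atK.
rewrite -Ek in kL.
have near_eq : \forall y \near l x,
    ((phi \o chart_inv k) \o transition l k) y = (phi \o chart_inv l) y.
  have : \forall y \near l x, chart_dom k (chart_inv l y).
    exact: (@chart_inv_cvg _ _ _ _ l _ (near_dom k)).
  by apply: filterS => y yk /=; rewrite chart_domK.
by apply: sd_near near_eq _; eexists; exact: sdiff_comp (sdiff_transition l k) kL.
Qed.

Lemma C1_msd phi : C1 phi <-> forall x, msd phi x.
Proof.
split=> [phi1 x k|phid h hA].
  have kx : chart_img k (k x) by exists x => //; exact: chart_at_dom.
  have := Ck1_sdiff (chart_img_open k) kx (phi1 k (chart_at_atlas k)).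
  by move=> h; eexists; exact: h.
apply: sdiff_Ck1; first exact: chart_img_open.
move=> _ [x hx <-]; have [L phiL] := phid x (ChartAt hA hx).
by exists L; exact: phiL.
Qed.

Lemma msd_near phi psi x : (\forall y \near x, phi y = psi y) -> msd phi x -> msd psi x.
Proof.
move=> pp px k; apply: sd_near (px k).
exact: (@chart_inv_cvg _ _ _ _ k _ pp).
Qed.

Lemma msd_cst a x : msd (fun _ => a) x.
Proof. by move=> k; exact: sd_cst. Qed.

Lemma msdD phi psi x : msd phi x -> msd psi x -> msd (fun y => phi y + psi y) x.
Proof. by move=> p1 p2 k; exact: sdD (p1 k) (p2 k). Qed.

Lemma msdM phi psi x : msd phi x -> msd psi x -> msd (fun y => phi y * psi y) x.
Proof. by move=> p1 p2 k; exact: sdM (p1 k) (p2 k). Qed.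

Lemma msdB phi psi x : msd phi x -> msd psi x -> msd (fun y => phi y - psi y) x.
Proof. by move=> p1 p2 k; exact: sdB (p1 k) (p2 k). Qed.

Lemma msdV phi x : phi x != 0 -> msd phi x -> msd (fun y => (phi y)^-1) x.
Proof.
by move=> p0 p1 k; apply: sdV (p1 k); rewrite /= chart_domK//; exact: chart_at_dom.
Qed.

End Msd.

(** * The Riemannian distance *)

Section RiemannianDistance.
Context {R : realType} {H : hilbertType R} {M : manifold H}.
Variable g : riemannian_metric M.
Implicit Types (p q x : M) (u : M -> R).

Lemma segment0 q (k : chart_at q) x y : chart_dom k x -> segment k (k x) y 0 = x.
Proof. by move=> kx; rewrite /segment scale0r addr0 chart_domK. Qed.

Lemma segment1 q (k : chart_at q) x y : chart_dom k x -> segment k y (k x) 1 = x.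
Proof. by move=> kx; rewrite /segment scale1r addrC subrK chart_domK. Qed.

Definition chart_ball q (k : chart_at q) r x := chart_dom k x /\ `|k x - k q| < r.

Lemma near_chart_ball q (k : chart_at q) r x : chart_ball k r x ->
  \forall y \near x, chart_ball k r y.
Proof.
move=> [kx xr].
have n1 := near_dom (rechart kx).
have kc : {for x, continuous k} by exact: (chart_continuous (k := rechart kx)).
have n2 : \forall y \near x, `|k y - k q| < r.
  have c : (fun y => `|k y - k q|) @ x --> `|k x - k q|.
    by apply: cvg_norm; apply: cvgB => //; exact: cvg_cst.
  exact: cvgr_lt _ c _ xr.
by apply: filterS2 n1 n2.
Qed.

(** If the ball met every neighborhood of [q], a segment in a chart at [q] would join one of its
    points to [q]. Being too short to cover the gap between [r] and [rho], it would end in the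
    domain of [h], and continuity of [h] would put [q] in the ball. *)
Lemma chart_ball_closed p (h : chart_at p) rho c C1 r q :
  metric_bounded g h rho c C1 -> r < rho ->
  ~ (chart_dom h q /\ `|h q - h p| <= r) ->
  \forall x \near q, ~ (chart_dom h x /\ `|h x - h p| <= r).
Proof.
move=> hb rr nS; apply: contrapT => nn; apply: nS.
have meet (B : set M) : nbhs q B -> exists x, [/\ B x, chart_dom h x & `|h x - h p| <= r].
  move=> qB; apply: contrapT => nB; apply: nn.
  by apply: filterS qB => x Bx [hx xr]; apply: nB; exists x.
have [_ c0 _ _ _] := hb.
pose k := some_chart q; have [sigma [c' [C kb]]] := metric_bounds g k.
have [s0 _ C0 _ _] := kb.
pose K := (rho - r) / 2; have K0 : 0 < K by rewrite divr_gt0// subr_gt0.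
pose d := Num.min sigma (K / (C / c)).
have d0 : 0 < d by rewrite lt_min s0 (divr_gt0 K0 (divr_gt0 C0 c0)).
have kq := chart_at_dom k.
have [|x [[kx xd] hx xr]] := meet (chart_ball k d).
  by apply: near_chart_ball; split=> //; rewrite subrr normr0.
have [hq _] : chart_dom h q /\ `|h q - h x| <= K * 1.
  have := segment_stays hb kb (a := k x) (b := k q) (r := r) (K := K).
  rewrite subrr normr0 segment0// => /(_ _ s0 hx xr) st.
  have := st _ _ _ 1; rewrite segment1//; apply.
  - by rewrite (lt_le_trans xd)// ge_min lexx.
  - rewrite distrC mulrC -ltr_pdivlMr ?divr_gt0// (lt_le_trans xd)//.
    by rewrite ge_min lexx orbT.
  - by rewrite /K; lra.
  - by rewrite ler01 lexx.
split=> //; rewrite leNgt; apply/negP => rq.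
have hc : {for q, continuous h} by exact: (chart_continuous (k := rechart hq)).
have n2 : \forall y \near q, r < `|h y - h p|.
  have c2 : (fun y => `|h y - h p|) @ q --> `|h q - h p|.
    by apply: cvg_norm; apply: cvgB => //; exact: cvg_cst.
  exact: cvgr_gt _ c2 _ rq.
by have [y [ry _]] := meet _ n2; rewrite leNgt ry.
Qed.

Definition ext p (h : chart_at p) rho (w : H -> R) x : R :=
  if `[< chart_ball h rho x >] then w (h x) else 0.

Lemma ext_in p (h : chart_at p) rho w x : chart_ball h rho x -> ext h rho w x = w (h x).
Proof. by move=> xb; rewrite /ext asboolT. Qed.

Lemma ext_neq0 p (h : chart_at p) rho w x : ext h rho w x != 0 ->
  chart_ball h rho x /\ w (h x) != 0.
Proof. by rewrite /ext; case: asboolP => //; rewrite eqxx. Qed.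

Section Extension.
Variables (p : M) (h : chart_at p) (rho c C r : R) (w : H -> R).
Hypothesis hb : metric_bounded g h rho c C.
Hypothesis rr : r < rho.
Hypothesis wr : forall y, r < `|y - h p| -> w y = 0.

(** Closedness of chart balls enters here: a point outside the ball of radius [rho] has a
    neighborhood that misses the closed ball of radius [r], off which [w] vanishes. *)
Lemma ext_near x : (exists hx : chart_dom h x, chart_ball h rho x /\
    \forall y \near x, ext h rho w y = w (h y)) \/
  (\forall y \near x, ext h rho w y = 0).
Proof.
have [xb|nxb] := pselect (chart_ball h rho x).
  left; have [hx _] := xb; exists hx; split=> //.
  by apply: filterS (near_chart_ball xb) => y /ext_in.
right; have nS : ~ (chart_dom h x /\ `|h x - h p| <= r).
  by move=> [hx xr]; apply: nxb; split=> //; exact: le_lt_trans rr.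
apply: filterS (chart_ball_closed hb rr nS) => y nSy.
apply/eqP; apply: contrapT => /negP/ext_neq0[[hy _]] /eqP; apply.
by apply: wr; rewrite ltNge; apply/negP => yr; apply: nSy.
Qed.

Lemma ext_msd : (forall y, sd w y) -> forall x, msd (ext h rho w) x.
Proof.
move=> wd x; have [[hx [xb xe]]|x0] := ext_near x; last first.
  apply: (@msd_near _ _ _ (fun _ => 0)); last exact: msd_cst.
  by apply: filterS x0 => y ->.
apply: (@msd_chart _ _ _ _ _ (rechart hx)).
apply: sd_near (wd _).
have n1 : \forall y \near rechart hx x,
    ext h rho w (chart_inv h y) = w (h (chart_inv h y)).
  exact: (@chart_inv_cvg _ _ _ _ (rechart hx) _ xe).
apply: filterS2 n1 (near_chart_img (rechart hx)) => y /= -> yi.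
by have [_ /= ->] := chart_imgP yi.
Qed.

End Extension.

(** Local Lipschitz constant at most 1 for the Riemannian norm, expressed without differentials so
    that cones over the norm of a chart qualify as well. *)
Definition slope1 u x := forall (k : chart_at x) L, 0 <= L ->
  (forall v : tangent x, tnorm g v <= L * `|dchart k v|) -> forall L', L < L' ->
  \forall y \near x, `|u y - u x| <= L' * `|k y - k x|.

(** One chart suffices: a slope bounded there by the lower constant of the metric is carried to the
    others by [transition_slope]. *)
Lemma slope1_chart u x (h : chart_at x) c : 0 < c ->
  (forall v : tangent x, c * `|dchart h v| <= tnorm g v) ->
  (\forall y \near x, `|u y - u x| <= c * `|h y - h x|) -> slope1 u x.
Proof.
move=> c0 hc uh k L L0 kL L' LL'.
have LL'c : L / c < L' / c by rewrite ltr_pM2r// invr_gt0.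
apply: filterS2 uh (transition_slope c0 hc kL LL'c) => y h1 h2.
by rewrite (le_trans h1)// -ler_pdivlMl// mulrA [c^-1 * _]mulrC.
Qed.

Lemma slope1_near u u' x : (\forall y \near x, u y = u' y) -> slope1 u x -> slope1 u' x.
Proof.
move=> uu' ux k L L0 kL L' LL'.
have ux' := nbhs_singleton uu'.
by apply: filterS2 uu' (ux k L L0 kL L' LL') => y <-; rewrite -ux'.
Qed.

Lemma slope1_cst a x : slope1 (fun _ => a) x.
Proof.
move=> k L L0 _ L' LL'; apply: nearW => y.
by rewrite subrr normr0 mulr_ge0// (le_trans L0)// ltW.
Qed.

Lemma slope1Z a u x : 0 <= a <= 1 -> slope1 u x -> slope1 (fun y => a * u y) x.
Proof.
move=> /andP[a0 a1] ux k L L0 kL L' LL'.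
apply: filterS (ux k L L0 kL L' LL') => y uy; apply: le_trans uy.
by rewrite -mulrBr normrM ger0_norm// ler_piMl.
Qed.

Lemma ext_slope1 p (h : chart_at p) rho c C r (w : H -> R) :
  metric_bounded g h rho c C -> r < rho ->
  (forall y, r < `|y - h p| -> w y = 0) ->
  (forall y, \forall z \near y, `|w z - w y| <= c * `|z - y|) ->
  forall x, slope1 (ext h rho w) x.
Proof.
move=> hb rr wr wc x; have [[hx [xb xe]]|x0] := ext_near hb rr wr x; last first.
  apply: (@slope1_near (fun _ => 0)); last exact: slope1_cst.
  by apply: filterS x0 => y ->.
have [_ c0 _ _ hN] := hb.
apply: (@slope1_chart _ _ (rechart hx) c) => //.
  by move=> v; have /andP[] := hN x (rechart hx) erefl xb.2 v.
have hc : {for x, continuous h} by exact: (chart_continuous (k := rechart hx)).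
have n1 : \forall y \near x, `|w (h y) - w (h x)| <= c * `|h y - h x|.
  exact: (hc _ (wc (h x))).
by apply: filterS2 xe n1 => y ->; rewrite (ext_in _ xb).
Qed.

(** Pointwise slopes are integrated along the chart segment, which stays in the ball by convexity.
    The resulting constant [C] is common to all functions of slope 1, as [sdiff_series] requires. *)
Lemma slope1_lip u q (k : chart_at q) rho c C x y : (forall z, slope1 u z) ->
  metric_bounded g k rho c C -> chart_ball k rho x -> chart_ball k rho y ->
  `|u x - u y| <= C * `|k x - k y|.
Proof.
move=> us [rho0 c0 C0 kB kN] [kx xr] [ky yr].
set gam := segment k (k y) (k x).
have slope (t : R) : 0 <= t <= 1 -> forall K' : R, C * `|k x - k y| < K' ->
    \forall s \near t, 0 <= s <= 1 -> `|u (gam s) - u (gam t)| <= K' * `|s - t|.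
  have ball t' : 0 <= t' <= 1 -> chart_ball k rho (gam t') /\
      k (gam t') = k y + t' *: (k x - k y).
    move=> t01; have tb := segment_ball yr xr t01.
    by have [kt ktE] := chart_imgP (kB _ tb); rewrite /chart_ball /gam /segment ktE.
  move=> t01 K' CK; have [[kt tb] ktE] := ball t t01.
  have [L LC LK] := exists_slope (normr_ge0 _) CK.
  have KC (v : tangent (gam t)) : tnorm g v <= C * `|dchart (rechart kt) v|.
    by have /andP[] := kN _ (rechart kt) erefl tb v.
  have gc : {for t, continuous gam}.
    by apply: segment_continuous; rewrite -ktE; exists (gam t).
  have n1 : \forall s \near t, `|u (gam s) - u (gam t)| <= L * `|k (gam s) - k (gam t)|.
    exact: (gc _ (us (gam t) (rechart kt) C (ltW C0) KC L LC)).
  apply: filterS n1 => s hs s01; apply: le_trans hs _.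
  rewrite ktE (ball s s01).2 opprD addrACA subrr add0r -scalerBl.
  by rewrite normrZ mulrCA mulrC ler_wpM2r.
have := slope_bound ler01 slope.
by rewrite /gam segment1// segment0// subr0 mulr1.
Qed.

(** Values in [0, 1] keep the supremum in [rdist] finite, even between different components of
    [M]. *)
Definition test u := (forall x, slope1 u x) /\ forall x, 0 <= u x <= 1.

(* By duality this is (a truncation of) the Riemannian distance; the
   definition by 1-Lipschitz functions avoids curves and their lengths. *)
Definition rdist x y : R := sup [set `|u x - u y| | u in test].

Lemma rdist_has_sup x y : has_sup [set `|u x - u y| | u in test].
Proof.
split.
  exists `|(0 : R) - 0|, (fun _ => 0) => //; split=> z; first exact: slope1_cst.
  by rewrite lexx ler01.
exists 1 => _ [u [_ u01] <-].
by have := u01 x; have := u01 y; rewrite ler_norml; lra.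
Qed.

Lemma rdist_ge u x y : test u -> `|u x - u y| <= rdist x y.
Proof. by move=> tu; apply: sup_upper_bound; [exact: rdist_has_sup|exists u]. Qed.

Lemma rdist_le x y a : (forall u, test u -> `|u x - u y| <= a) -> rdist x y <= a.
Proof.
by move=> H1; apply: ge_sup; [case: (rdist_has_sup x y)|move=> _ [u tu <-]; exact: H1].
Qed.

Lemma rdistC x y : rdist x y = rdist y x.
Proof.
by apply/eqP; rewrite eq_le; apply/andP; split; apply: rdist_le => u tu;
  rewrite distrC; exact: rdist_ge.
Qed.

Lemma rdist_triangle y x z : rdist x z <= rdist x y + rdist y z.
Proof.
apply: rdist_le => u tu; rewrite (le_trans (ler_distD (u y) _ _))//.
by rewrite lerD// rdist_ge.
Qed.

Lemma rdist_le_chart q (k : chart_at q) rho c C x y : metric_bounded g k rho c C ->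
  chart_ball k rho x -> chart_ball k rho y -> rdist x y <= C * `|k x - k y|.
Proof. by move=> kb xb yb; apply: rdist_le => u [us _]; exact: slope1_lip kb xb yb. Qed.

Lemma near_rdist x e : 0 < e -> \forall y \near x, rdist x y < e.
Proof.
move=> e0; pose k := some_chart x; have [rho [c [C kb]]] := metric_bounds g k.
have [rho0 _ C0 _ _] := kb.
have xb : chart_ball k (Num.min rho (e / C)) x.
  by split; [exact: chart_at_dom|rewrite subrr normr0 lt_min rho0 divr_gt0].
apply: filterS (near_chart_ball xb) => y [ky]; rewrite lt_min => /andP[yr ye].
apply: le_lt_trans (rdist_le_chart kb _ _) _ => //.
  by split; [exact: chart_at_dom|rewrite subrr normr0].
by rewrite distrC mulrC -ltr_pdivlMr.
Qed.

(** A cone with vertex over [p], zero off the ball of radius [r], is a test function separating [p]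
    from the complement. Its steepness is at most [c] for the slope and at most 1/r for the values
    to stay below 1. *)
Lemma rdist_chart_ball p (h : chart_at p) rho c C r : metric_bounded g h rho c C ->
  0 < r < rho -> exists2 d, 0 < d & forall x, rdist p x < d -> chart_ball h r x.
Proof.
move=> hb /andP[r0 rr]; have [_ c0 _ _ _] := hb.
pose s := Num.min c r^-1; have s0 : 0 < s by rewrite lt_min c0 invr_gt0.
have sr1 : s * r <= 1 by rewrite -ler_pdivlMr// div1r ge_min lexx orbT.
pose w (y : H) := s * Num.max 0 (r - `|y - h p|).
have w01 y : 0 <= w y <= s * r.
  rewrite mulr_ge0 ?(ltW s0) ?le_max ?lexx//= ler_pM2l// ge_max (ltW r0)/=.
  by rewrite gerBl.
have tw : test (ext h rho w).
  split; last first.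
    move=> x; rewrite /ext; case: asboolP => _; last by rewrite lexx ler01.
    by have /andP[-> /le_trans->] := w01 (h x).
  apply: (ext_slope1 hb rr) => [y ry|y].
    by rewrite /w (max_idPl _) ?mulr0// subr_le0 ltW.
  apply: nearW => z; rewrite /w -mulrBr normrM gtr0_norm//.
  apply: ler_pM; rewrite ?(ltW s0)//; first by rewrite ge_min lexx.
  have := lerB_dist (z - h p) (y - h p); have := lerB_dist (y - h p) (z - h p).
  rewrite [in X in _ -> X -> _](_ : z - h p - (y - h p) = z - y); last first.
    by rewrite opprB addrA subrK.
  rewrite (_ : y - h p - (z - h p) = y - z); last by rewrite opprB addrA subrK.
  have := normr_ge0 (z - y); rewrite (distrC y z).
  move: (`|z - h p|) (`|y - h p|) (`|z - y|) => a b e h0 h1 h2.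
  by rewrite ler_norml; case: (leP 0 (r - a)) => ?; case: (leP 0 (r - b)) => ?; lra.
have pb : chart_ball h rho p.
  by split; [exact: chart_at_dom|rewrite subrr normr0 (lt_trans r0)].
exists (s * r) => [|x xd]; first by rewrite mulr_gt0.
apply: contrapT => nx; have := rdist_ge p x tw; rewrite leNgt => /negP; apply.
have ux : ext h rho w x = 0.
  rewrite /ext; case: asboolP => // -[hx xr]; rewrite /w (max_idPl _) ?mulr0//.
  by rewrite subr_le0 leNgt; apply/negP => ?; apply: nx; split.
rewrite (lt_le_trans xd)// ux (ext_in _ pb) /w subrr normr0 !subr0.
by rewrite (max_idPr (ltW r0)) ler_norm.
Qed.

Lemma bump_function p (h : chart_at p) rho c C r (T : set M) e :
  metric_bounded g h rho c C -> r < rho -> (forall t, T t -> chart_ball h r t) -> 0 < e ->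
  exists u : M -> R, [/\ forall x, msd u x, test u, forall t, T t -> 0 < u t &
    forall x, u x != 0 -> exists2 t, T t & rdist t x < e].
Proof.
move=> hb rr Tr e0.
have [[t0 Tt0]|T0] := pselect (T !=set0); last first.
  exists (fun _ => 0); split=> [x||t Tt|x]; first exact: msd_cst.
  - by split=> x; [exact: slope1_cst|rewrite lexx ler01].
  - by exfalso; apply: T0; exists t.
  - by rewrite eqxx.
have [rho0 c0 C0 _ _] := hb.
(* The three terms serve [smooth_bump], which wants d < 1, the inclusion of the support in the ball
   of radius [rho], and the conversion of chart distance into [rdist]. *)
pose d := Num.min (1 / 2) (Num.min ((rho - r) / 2) (e / C)).
have d0 : 0 < d by rewrite !lt_min !divr_gt0// subr_gt0.
have d1 : d < 1 by rewrite gt_min; apply/orP; left; lra.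
have [|w [wd w01 wT wd0 ws]] := @smooth_bump _ _ (h @` T) d _ ltac:(by rewrite d0).
  by exists (h t0), t0.
(* This turns the Lipschitz constant 24 of [smooth_bump] into a constant at most [c], hence into
   slope at most 1. *)
pose s := Num.min 1 (c / 24); have s0 : 0 < s by rewrite lt_min ltr01 divr_gt0.
have s1 : s <= 1 by rewrite ge_min lexx.
have rd : r + d < rho.
  have : d <= (rho - r) / 2 by rewrite !ge_min lexx !orbT.
  by move: rr; lra.
pose w' y := s * w y.
have w'0 y : r + d < `|y - h p| -> w' y = 0.
  move=> yr; apply/eqP; rewrite mulf_eq0; apply/orP; right; apply: contrapT => /negP wy.
  have [_ [t Tt <-] ytd] := wd0 _ wy; have [_ tr] := Tr t Tt.
  by have := ler_distD (h t) y (h p); lra.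
have sc : s * 24 <= c by rewrite -ler_pdivlMr// ge_min lexx orbT.
exists (ext h rho w'); split.
- by apply: ext_msd hb rd w'0 _ => y; exact: sdZ.
- split=> x.
    apply: (ext_slope1 hb rd w'0) => y; apply: filterS (ws y) => z wz.
    rewrite -mulrBr normrM gtr0_norm// (@le_trans _ _ (s * (24 * `|z - y|)))//.
      by rewrite ler_pM2l.
    by rewrite mulrA ler_wpM2r.
  rewrite /ext; case: asboolP => _; last by rewrite lexx ler01.
  have /andP[wx0 wx1] := w01 (h x).
  by rewrite mulr_ge0 ?(ltW s0)//= mulr_ile1// ltW.
- move=> t Tt; have [ht tr] := Tr t Tt.
  rewrite ext_in; last by split=> //; exact: lt_trans tr rr.
  by rewrite mulr_gt0// wT//; exists t.
- move=> x /ext_neq0[xb]; rewrite mulf_eq0 negb_or => /andP[_ /wd0[_ [t Tt <-] xt]].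
  exists t => //; have [ht tr] := Tr t Tt.
  rewrite rdistC (le_lt_trans (rdist_le_chart hb xb _))//.
    by split=> //; exact: lt_trans tr rr.
  rewrite mulrC -ltr_pdivlMr// (lt_le_trans xt)//.
  by rewrite !ge_min lexx !orbT.
Qed.

End RiemannianDistance.

(** * C^1 minorants *)

(** Well-ordering the indices selects a first set around each point. Antisymmetry will force two
    pieces that lie in each other's sets to have the same index. *)
Lemma exists_first_index (T : eqType) (X : Type) (U : T -> set X) (i : X -> T) :
  (forall x, U (i x) x) ->
  exists (le : T -> T -> Prop) (first : X -> T),
    [/\ forall s t, le s t -> le t s -> s = t,
        forall x, U (first x) x & forall x t, U t x -> le (first x) t].
Proof.
move=> Ui; have [le wo] := wochoice.well_ordering_principle T.
have anti s t : le s t -> le t s -> s = t.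
  move=> st ts.
  have wT : wochoice.wo_chain le (predT : {pred T}) by exact: wochoice.withinW wo.
  by apply: (wochoice.wo_chain_antisymmetric wT) => //; rewrite st ts.
have /choice[first firstP] x : exists t, U t x /\ forall s, U s x -> le t s.
  have [|z [[zU zle] _]] := wo [pred t | `[< U t x >]].
    by exists (i x); rewrite unfold_in /=; exact/asboolP.
  exists z; split; first by move: zU; rewrite unfold_in /= => /asboolP.
  by move=> s sx; apply: zle; rewrite unfold_in /=; exact/asboolP.
by exists le, first; split=> // x; have [] := firstP x.
Qed.

Section HalfPowers.
Context {R : realType}.

Lemma sum_half_pow n : \sum_(0 <= i < n) (2^-1 : R) ^+ i.+1 = 1 - 2^-1 ^+ n.
Proof.
elim: n => [|n IH]; first by rewrite big_nil expr0 subrr.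
by rewrite big_nat_recr//= IH exprS; lra.
Qed.

Lemma sum_half_pow_le n : \sum_(0 <= i < n) (2^-1 : R) ^+ i.+1 <= 1.
Proof. by rewrite sum_half_pow gerBl exprn_ge0// invr_ge0 ler0n. Qed.

Lemma half_pow_ge0 n : 0 <= (2^-1 : R) ^+ n.
Proof. by rewrite exprn_ge0// invr_ge0 ler0n. Qed.

End HalfPowers.

(** The bound [B] depends on the point because it is applied both to bumps bounded by 1 and to terms
    bounded by a multiple of the norm. *)
Lemma half_series (R : realType) (X : Type) (s : nat -> X -> R) (B : X -> R) :
  (forall n x, 0 <= s n x <= B x) -> exists S : X -> R,
    (forall x, series (fun n => 2^-1 ^+ n.+1 * s n x) @ \oo --> S x) /\
    forall n x, 2^-1 ^+ n.+1 * s n x <= S x.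
Proof.
move=> sB; pose u n x := 2^-1 ^+ n.+1 * s n x.
have u0 n x : 0 <= u n x by rewrite mulr_ge0 ?half_pow_ge0//; have /andP[] := sB n x.
have nd x : {homo series (u^~ x) : i j / (i <= j)%N >-> i <= j}.
  by apply: nondecreasing_series => i _ _; exact: u0.
have cv x : cvgn (series (u^~ x)).
  apply: nondecreasing_is_cvgn => //; exists (B x) => _ [n _ <-].
  have /andP[s0 sb] := sB 0%N x; have B0 := le_trans s0 sb.
  apply: (@le_trans _ _ (\sum_(0 <= i < n) 2^-1 ^+ i.+1 * B x)).
    apply: ler_sum => i _; rewrite ler_wpM2l ?half_pow_ge0//.
    by have /andP[] := sB i x.
  by rewrite -mulr_suml ler_piMl// sum_half_pow_le.
exists (fun x => limn (series (u^~ x))); split=> [x|n x]; first exact: cv.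
apply: le_trans (nondecreasing_cvgn_le (nd x) (cv x) n.+1).
by rewrite /series /= big_nat_recr//= lerDr sumr_ge0.
Qed.

Section PartitionOfUnity.
Context {R : realType} {H : hilbertType R} {M : manifold H}.
Variable g : riemannian_metric M.
Implicit Types (p q x : M).

Lemma chart_ball_basis q (k : chart_at q) (B : set M) : nbhs q B ->
  exists2 r, 0 < r & forall x, chart_ball k r x -> B x.
Proof.
move=> qB; have : \forall y \near k q, B (chart_inv k y) by exact: (@chart_inv_cvg _ _ _ _ k _ qB).
move=> /nbhs_ballP[r /= r0 rB]; exists r => // x [kx xr].
have := rB (k x); rewrite -ball_normE /= distrC chart_domK//; exact.
Qed.

Lemma rdist_nbhs q (B : set M) : nbhs q B ->
  exists2 e, 0 < e & forall x, rdist g q x < e -> B x.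
Proof.
move=> qB; pose k := some_chart q; have [r r0 rB] := chart_ball_basis k qB.
have [rho [c [C kb]]] := metric_bounds g k; have [rho0 _ _ _ _] := kb.
pose r' := Num.min r (rho / 2).
have r'0 : 0 < r' by rewrite lt_min r0 divr_gt0.
have r'rho : r' < rho by rewrite gt_min; apply/orP; right; lra.
have [|e e0 eP] := rdist_chart_ball kb (_ : 0 < r' < rho); first by rewrite r'0.
exists e => // x /eP[kx xr]; apply: rB; split=> //.
by rewrite (lt_le_trans xr)// ge_min lexx.
Qed.

Section Cover.
Variables (U : M -> set M) (m : M -> R).
Hypothesis Uopen : forall q x, U q x -> nbhs x (U q).
Hypothesis m_ge0 : forall q, 0 <= m q.
Hypothesis Ubump : forall q (T : set M) e, (forall t, T t -> U q t) -> 0 < e ->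
  exists u : M -> R, [/\ forall x, msd u x, test g u, forall t, T t -> 0 < u t &
    forall x, u x != 0 -> exists2 t, T t & rdist g t x < e].

Variables (le : M -> M -> Prop) (first : M -> M).
Hypothesis le_anti : forall q q', le q q' -> le q' q -> q = q'.
Hypothesis first_in : forall x, U (first x) x.
Hypothesis first_le : forall x q, U q x -> le (first x) q.

(* Stone's construction: attributing every point to the first set of the cover
   that contains it separates by [n.+1^-1] the pieces of level [n], so that the
   supports of their bump functions form a discrete family. *)
Lemma exists_discrete_sum n : exists s : M -> R,
  [/\ forall x, msd s x, test g s,
      forall x, (forall y, rdist g x y < n.+1%:R^-1 -> U (first x) y) -> 0 < s x &
      forall x (a : R), (forall q, U q x -> a <= m q) -> s x * a <= 1].
Proof.
pose N : R := n.+1%:R^-1; have N0 : 0 < N by rewrite invr_gt0 ltr0n.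
pose T q := [set x | first x = q /\ forall y, rdist g x y < N -> U q y].
have TU q x : T q x -> U q x by move=> [<- _]; exact: first_in.
have N30 : 0 < N / 3 by lra.
have /choice[tau tauP] q := Ubump (@TU q) N30.
have mq q : 0 < 1 + m q by have := m_ge0 q; lra.
(* Each bump reaches less than N/3 from its piece, so a gap below N/3 between the supports puts [t]
   and [t'] at distance less than N. Each then lies in the set attributed to the other, and both
   indices come first. *)
have tsep q q' x x' : tau q x != 0 -> tau q' x' != 0 -> rdist g x x' < N / 3 -> q = q'.
  have [_ _ _ tq] := tauP q; have [_ _ _ tq'] := tauP q'.
  move=> /tq[t [tE tU] tx] /tq'[t' [t'E t'U] t'x'] xx'.
  have tt' : rdist g t t' < N.
    have := rdist_triangle g x t t'; have := rdist_triangle g x' x t'.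
    by rewrite (rdistC g x' t'); lra.
  have Ut' := tU _ tt'; have Ut := t'U t; rewrite rdistC in Ut; have {}Ut := Ut tt'.
  have l1 := first_le Ut'; have l2 := first_le Ut.
  by rewrite t'E in l1; rewrite tE in l2; exact: le_anti.
have tsep1 q q' x : tau q x != 0 -> tau q' x != 0 -> q = q'.
  move=> qx q'x; apply: tsep qx q'x _; apply: le_lt_trans N30.
  by apply: rdist_le => u _; rewrite subrr normr0.
(* At most one bump is nonzero at [x], so the sum over [q] is a single term. The factor
   [(1 + m q)^-1] gives the bound on [s x * a] and, being at most 1, does not increase the slope. *)
have /choice[s sP] x : exists s : R,
    (forall q, tau q x != 0 -> s = (1 + m q)^-1 * tau q x) /\
    ((forall q, tau q x = 0) -> s = 0).
  have [[q qx]|nq] := pselect (exists q, tau q x != 0).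
    exists ((1 + m q)^-1 * tau q x); split=> [q' q'x|/(_ q) q0].
      by rewrite (tsep1 _ _ _ qx q'x).
    by rewrite q0 eqxx in qx.
  by exists 0; split=> // q qx; exfalso; apply: nq; exists q.
(* Two points within N/6 of [z] are less than N/3 apart, so one index serves the whole
   neighborhood. *)
have sloc (z : M) : exists q, \forall x \near z, (1 + m q)^-1 * tau q x = s x.
  have near6 : \forall x \near z, rdist g z x < N / 6 by apply: near_rdist; lra.
  have [[x0 [q [x0z qx0]]]|nq] := pselect (exists x q, rdist g z x < N / 6 /\ tau q x != 0).
    exists q; apply: filterS near6 => x xz.
    have [q0|qx] := eqVneq (tau q x) 0; last by rewrite ((sP x).1 _ qx).
    rewrite q0 mulr0.
    have [[q' q'x]|nq] := pselect (exists q', tau q' x != 0); last first.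
      rewrite (sP x).2// => q'; apply/eqP; apply: contrapT => /negP q'x.
      by apply: nq; exists q'.
    have qq' : q = q'.
      apply: tsep qx0 q'x _; have := rdist_triangle g z x0 x.
      by rewrite (rdistC g x0 z); lra.
    by rewrite -qq' q0 eqxx in q'x.
  exists z; apply: filterS near6 => x xz.
  have tx0 q : tau q x = 0.
    by apply/eqP; apply: contrapT => /negP qx; apply: nq; exists x, q.
  by rewrite tx0 mulr0 (sP x).2.
have mq1 q : (1 + m q)^-1 <= 1 by rewrite invf_le1//; have := m_ge0 q; lra.
have s01 x : 0 <= s x <= 1.
  have [[q qx]|nq] := pselect (exists q, tau q x != 0); last first.
    rewrite (sP x).2 ?lexx ?ler01// => q; apply/eqP; apply: contrapT => /negP qx.
    by apply: nq; exists q.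
  have [_ [_ /(_ x)/andP[t0 t1]] _ _] := tauP q.
  by rewrite ((sP x).1 _ qx) mulr_ge0 ?mulr_ile1// invr_ge0 ltW.
exists s; split.
- move=> z; have [q qs] := sloc z; apply: msd_near qs _.
  by have [td _ _ _] := tauP q; apply: msdM; [exact: msd_cst|exact: td].
- split=> // z; have [q qs] := sloc z; apply: slope1_near qs _.
  apply: slope1Z; last by have [_ [ts _] _ _] := tauP q; exact: ts.
  by rewrite mq1 invr_ge0 (ltW (mq q)).
- move=> x xU; have Tx : T (first x) x by [].
  have [_ _ tp _] := tauP (first x); have tx := tp _ Tx.
  by rewrite ((sP x).1 _ (lt0r_neq0 tx)) mulr_gt0// invr_gt0.
- move=> x a aU.
  have [[q qx]|nq] := pselect (exists q, tau q x != 0); last first.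
    rewrite (sP x).2 ?mul0r ?ler01// => q; apply/eqP; apply: contrapT => /negP qx.
    by apply: nq; exists q.
  have [_ [_ t01] _ tq] := tauP q; have [t [tE tU] tx] := tq _ qx.
  have /aU aq : U q x by apply: tU; lra.
  rewrite ((sP x).1 _ qx) mulrAC -mulrA mulrC ler_pdivrMr// mul1r.
  have /andP[h0 h1] := t01 x; have := m_ge0 q.
  have [a0|a0] := leP a 0.
    have : a * tau q x <= 0 by rewrite mulr_le0_ge0.
    by lra.
  have : a * tau q x <= a by rewrite ler_piMr// ltW.
  by lra.
Qed.

(** The levels are averaged with weights of sum at most 1, which preserves the last property.
    Positivity at [x] comes from a level finer than the distance from [x] to the complement of its
    first set; [slope1_lip] gives the Lipschitz bounds for [sdiff_series]. *)
Lemma exists_C1_scale : exists s : M -> R,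
  [/\ forall x, msd s x, forall x, 0 < s x &
      forall x (a : R), (forall q, U q x -> a <= m q) -> s x * a <= 1].
Proof.
have /choice[s sP] n := exists_discrete_sum n.
have s01 n x : 0 <= s n x <= 1 by have [_ [_]] := sP n.
have [S [cv ge]] := half_series s01.
exists S; split.
- move=> z; pose k := some_chart z; apply: (msd_chart (k := k)).
  have [rho [c [C kb]]] := metric_bounds g k; have [rho0 _ C0 kB _] := kb.
  apply: (sdiff_series (u := fun n y => 2^-1 ^+ n.+1 * s n (chart_inv k y)) rho0 (ltW C0)).
  + move=> n y y' yz y'z.
    have [ky kyE] := chart_imgP (kB _ yz); have [ky' ky'E] := chart_imgP (kB _ y'z).
    have [_ [ss _] _ _] := sP n.
    have := slope1_lip ss kb (x := chart_inv k y) (y := chart_inv k y').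
    rewrite /chart_ball kyE ky'E => /(_ (conj ky yz) (conj ky' y'z)) sl.
    rewrite -mulrBr normrM ger0_norm ?half_pow_ge0// exprS.
    have h0 := half_pow_ge0 (R := R) n.
    have : 2^-1 ^+ n * `|s n (chart_inv k y) - s n (chart_inv k y')| <=
      2^-1 ^+ n * (C * `|y - y'|) by rewrite ler_wpM2l.
    have : 0 <= 2^-1 ^+ n * (C * `|y - y'|) by rewrite mulr_ge0// mulr_ge0// ltW.
    by lra.
  + move=> n; have [sd _ _ _] := sP n.
    by apply: sdZ; exact: sd.
  + by move=> y _; exact: cv.
- move=> x; have [e e0 eU] := rdist_nbhs (Uopen (first_in x)).
  pose N := Num.bound e^-1.
  have nN : N.+1%:R^-1 <= e.
    have eN : e^-1 <= N.+1%:R.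
      have e10 : 0 <= e^-1 by rewrite invr_ge0 ltW.
      by rewrite (le_trans (ltW (archi_boundP e10)))// ler_nat.
    by rewrite -[leRHS]invrK lef_pV2// posrE ?invr_gt0// ltr0n.
  have [_ _ sp _] := sP N.
  have sx : 0 < s N x by apply: sp => y xy; apply: eU; exact: lt_le_trans nN.
  apply: lt_le_trans (ge N x).
  by rewrite mulr_gt0// exprn_gt0// invr_gt0 ltr0n.
- move=> x a aU.
  have Ta n : series (fun n => 2^-1 ^+ n.+1 * s n x) n * a <= 1.
    rewrite (le_trans _ (sum_half_pow_le n))// /series /= mulr_suml ler_sum// => i _.
    rewrite -mulrA ler_piMr ?half_pow_ge0//.
    by have [_ _ _ +] := sP i; apply.
  have cva : series (fun n => 2^-1 ^+ n.+1 * s n x) n * a @[n --> \oo] --> S x * a.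
    by apply: cvgM; [exact: cv|exact: cvg_cst].
  rewrite -(cvg_lim _ cva)//; apply: limr_le; first by apply/cvg_ex; eexists; exact: cva.
  by apply: nearW => n; exact: Ta.
Qed.

End Cover.

Lemma exists_C1_minorant (f : M -> \bar R) : locally_bounded_below f ->
  exists2 psi : M -> R, C1 psi & forall x, ((psi x)%:E <= f x)%E.
Proof.
move=> fb.
have /choice[U UP] q : exists U : set M, exists m : R, [/\ U q,
    forall x, U x -> nbhs x U, 0 <= m, forall x, U x -> ((- m)%:E <= f x)%E &
    forall (T : set M) e, (forall t, T t -> U t) -> 0 < e ->
      exists u : M -> R, [/\ forall x, msd u x, test g u, forall t, T t -> 0 < u t &
        forall x, u x != 0 -> exists2 t, T t & rdist g t x < e]].
  have [a fa] := fb q; pose k := some_chart q.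
  have [r0 r00 rf] := chart_ball_basis k fa.
  have [rho [c [C kb]]] := metric_bounds g k; have [rho0 _ _ _ _] := kb.
  pose r := Num.min r0 (rho / 2).
  have rr0 : r <= r0 by rewrite ge_min lexx.
  have rrho : r < rho by rewrite gt_min; apply/orP; right; lra.
  exists (chart_ball k r), `|a|; split.
  - split; first exact: chart_at_dom.
    by rewrite subrr normr0 lt_min r00 divr_gt0.
  - by move=> x; exact: near_chart_ball.
  - exact: normr_ge0.
  - move=> x [kx xr]; apply: le_trans (rf x _); last by split=> //; exact: lt_le_trans rr0.
    by rewrite lee_fin lerNl (le_trans (ler_norm _))// normrN.
  - by move=> T e TU e0; exact: bump_function kb rrho TU e0.
have /choice[m mP] := UP.
have [le [first [le_anti fi fl]]] :=
  @exists_first_index M M U id (fun q => let: And5 h _ _ _ _ := mP q in h).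
have [s [sd s0 sm]] := @exists_C1_scale U m
  (fun q => let: And5 _ h _ _ _ := mP q in h)
  (fun q => let: And5 _ _ h _ _ := mP q in h)
  (fun q => let: And5 _ _ _ _ h := mP q in h) le first le_anti fi fl.
exists (fun x => 0 - (s x)^-1).
  by apply/C1_msd => x; apply: msdB; [exact: msd_cst|apply: msdV => //; rewrite gt_eqF].
move=> x; have [Ux _ _ /(_ _ (Ux))fx _] := mP x.
case fxE : (f x) => [b| |]; last by rewrite fxE leeNy_eq in fx.
  have : s x * (- b) <= 1.
    (* Every set of the cover around [x] gives -m q <= b, so [- b] is an admissible value of [a]. *)
    apply: sm => q qx; have [_ _ _ /(_ _ qx) + _] := mP q.
    by rewrite fxE lee_fin; lra.
  by move=> sb; rewrite lee_fin sub0r lerNl -(ler_pM2l (s0 x)) mulfV ?gt_eqF.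
by rewrite leey.
Qed.

End PartitionOfUnity.

(** * Local C^1 functions on a Hilbert space *)

Section HilbertSpace.
Context {R : realType} {H : hilbertType R}.
Implicit Types (x y v : H).

Lemma sdiff_min (f : H -> R) x (L : H -> R) : sdiff f x L ->
  (forall y, f x <= f y) -> forall v, L v = 0.
Proof.
move=> fL fx; have [[lL _] _] := fL.
suff N v : - L v <= 0.
  move=> v; apply/eqP; rewrite eq_le; have := N v; have := N (- v).
  by rewrite (linNR lL); lra.
apply: (@le0_forall_eps _ _ `|v|) => e e0; have [d d0 fd] := fL.2 e e0.
have v1 : 0 < `|v| + 1 by rewrite ltr_wpDl.
pose t := d / 2 / (`|v| + 1); have t0 : 0 < t by rewrite !divr_gt0.
have tv : `|t *: v| < d.
  rewrite (normrZ t) (gtr0_norm t0) /t mulrAC ltr_pdivrMr//.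
  have := mulr_ge0 (ltW d0) (normr_ge0 v); move: (`|v|) => b.
  lra.
have := fd (t *: v + x) x; rewrite addrK subrr normr0 => /(_ tv d0).
rewrite (linZR lL) (normrZ t) (gtr0_norm t0) ler_norml => /andP[h1 h2].
have := fx (t *: v + x) => h3.
by rewrite -(ler_pM2l t0); lra.
Qed.

(** The inner [pos2] is at least 1 on the ball of radius [r] and vanishes at distance sqrt(2) r and
    beyond; the map 1 - pos2 (1 - t) truncates it at 1 in a C^1 way. *)
Definition cutoff (c : H) (r : R) (y : H) : R :=
  1 - pos2 (1 - pos2 (2 - r ^- 2 * `|y - c| ^+ 2)).

Lemma sd_cutoff c r y : sd (cutoff c r) y.
Proof.
apply: sdB; first exact: sd_cst.
apply: sd_pos2; apply: sdB; first exact: sd_cst.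
apply: sd_pos2; apply: sdB; first exact: sd_cst.
by apply: sdZ; exact: sd_sqdist.
Qed.

Lemma cutoff01 c r y : 0 <= cutoff c r y <= 1.
Proof.
by rewrite /cutoff subr_ge0 pos2_le1// gerBl pos2_ge0.
Qed.

Lemma cutoff1 c r y : 0 < r -> `|y - c| <= r -> cutoff c r y = 1.
Proof.
move=> r0 yr; rewrite /cutoff (@pos2_le0 _ (1 - _)) ?subr0// subr_le0.
apply: pos2_ge1.
have : r ^- 2 * `|y - c| ^+ 2 <= 1.
  by rewrite mulrC ler_pdivrMr ?exprn_gt0// mul1r ler_pXn2r ?nnegrE ?(ltW r0).
by lra.
Qed.

Lemma cutoff0 c r y : 0 < r -> 2 * r < `|y - c| -> cutoff c r y = 0.
Proof.
move=> r0 yr; rewrite /cutoff (@pos2_le0 _ (2 - _)).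
  by rewrite subr0 /pos2 (max_idPr ler01) expr1n subrr.
have : 4 <= r ^- 2 * `|y - c| ^+ 2.
  rewrite mulrC ler_pdivlMr ?exprn_gt0// (_ : 4 * r ^+ 2 = (2 * r) ^+ 2); last by ring.
  by rewrite ler_pXn2r ?nnegrE ?mulr_ge0 ?(ltW r0)// ltW.
by lra.
Qed.

(** The norm smoothed at scale [d]. Since sqrt(2) - 1 >= 1/3, the factor 6 yields at least 2|v| once
    |v| >= d; this 2 will compensate the half in the weights 2^-(n+1). *)
Definition smooth_abs (d : R) (v : H) : R := 6 * (Num.sqrt (`|v| ^+ 2 + d ^+ 2) - d).

Lemma sd_smooth_abs d v : 0 < d -> sd (smooth_abs d) v.
Proof.
move=> d0; apply: sdZ; apply: sdB; last exact: sd_cst.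
apply: sd_sqrt; first by rewrite ltr_wpDl ?sqr_ge0// exprn_gt0.
by apply: sdD; [eexists; exact: sdiff_sqnorm|exact: sd_cst].
Qed.

Lemma smooth_abs_lip d v w : 0 < d -> `|smooth_abs d v - smooth_abs d w| <= 6 * `|v - w|.
Proof.
move=> d0; rewrite /smooth_abs -mulrBr normrM ger0_norm// ler_pM2l//.
rewrite opprB addrA subrK.
have := lerB_dist v w; have := lerB_dist w v; rewrite (distrC w v).
have : 0 <= `|v| by []; have : 0 <= `|w| by [].
move: (`|v|) (`|w|) (`|v - w|) => a b e a0 b0 h1 h2.
have A0 : 0 <= a ^+ 2 + d ^+ 2 by rewrite addr_ge0// sqr_ge0.
have B0 : 0 <= b ^+ 2 + d ^+ 2 by rewrite addr_ge0// sqr_ge0.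
have sA := sqr_sqrtr A0; have sB := sqr_sqrtr B0.
have pA := sqrtr_ge0 (a ^+ 2 + d ^+ 2); have pB := sqrtr_ge0 (b ^+ 2 + d ^+ 2).
move: (Num.sqrt (a ^+ 2 + d ^+ 2)) (Num.sqrt (b ^+ 2 + d ^+ 2)) sA sB pA pB.
move=> A B sA sB pA pB.
have aA : b <= B by nra.
have bB : a <= A by nra.
have B1 : 0 < B by nra.
rewrite ler_norml; apply/andP; split; nra.
Qed.

Lemma smooth_abs0 d : 0 < d -> smooth_abs d 0 = 0.
Proof.
by move=> d0; rewrite /smooth_abs normr0 expr0n add0r sqrtr_sqr gtr0_norm// subrr mulr0.
Qed.

Lemma smooth_abs_ge0 d v : 0 < d -> 0 <= smooth_abs d v.
Proof.
move=> d0; rewrite mulr_ge0// subr_ge0 -[leLHS]gtr0_norm// -sqrtr_sqr.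
by rewrite ler_wsqrtr// lerDr sqr_ge0.
Qed.

Lemma smooth_abs_ge d v : 0 < d -> d <= `|v| -> 2 * `|v| <= smooth_abs d v.
Proof.
move=> d0 dv; rewrite /smooth_abs.
have A0 : 0 <= `|v| ^+ 2 + d ^+ 2 by rewrite addr_ge0// sqr_ge0.
have sA := sqr_sqrtr A0; have pA := sqrtr_ge0 (`|v| ^+ 2 + d ^+ 2).
move: (`|v|) (Num.sqrt _) dv sA pA => a A dv sA pA.
nra.
Qed.

(** [Q v t] reads as an error [t] being sufficient at [v]. On each shell between consecutive radii a
    single term of the series dominates the error required there. The sum is nonnegative and
    vanishes at 0, so its differential at 0 is zero. *)
Lemma exists_C1_remainder (Q : H -> R -> Prop) :
  (forall v s t, s <= t -> Q v s -> Q v t) ->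
  (forall e, 0 < e -> exists2 d, 0 < d & forall v, `|v| < d -> Q v (e * `|v|)) ->
  exists theta : H -> R, [/\ theta 0 = 0, sdiff theta 0 (fun _ => 0),
    forall v, sd theta v &
    exists2 d, 0 < d & forall v, `|v| < d -> Q v (theta v)].
Proof.
move=> Qmono Qe.
have /choice[d dP] (n : nat) : exists d, 0 < d <= 2^-1 ^+ n /\
    forall v, `|v| < d -> Q v (2^-1 ^+ n * `|v|).
  have e0 : 0 < (2^-1 : R) ^+ n by rewrite exprn_gt0// invr_gt0 ltr0n.
  have [d d0 dQ] := Qe _ e0; exists (Num.min d (2^-1 ^+ n)).
  rewrite lt_min d0 e0 ge_min lexx orbT; split=> // v.
  by rewrite lt_min => /andP[/dQ].
have d0 n : 0 < d n by have [/andP[]] := dP n.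
(* The shift of index matters: term [n] must be large already from the inner radius [d n.+1] of the
   shell where the error 2^-n |v| is required. *)
pose s n v := smooth_abs (d n.+1) v.
have sB n v : 0 <= s n v <= 6 * `|v|.
  rewrite smooth_abs_ge0//=; have := smooth_abs_lip v 0 (d0 n.+1).
  by rewrite smooth_abs0// !subr0; apply: le_trans; exact: ler_norm.
have [S [Sc Sge]] := half_series sB.
have S0 : S 0 = 0.
  have := Sc 0; rewrite (_ : series _ = fun _ => 0).
    by move=> /(cvg_lim _) <-//; rewrite lim_cst.
  apply/funext => n; rewrite /series /= big1// => i _.
  by rewrite /s smooth_abs0// mulr0.
have Sd v : sd S v.
  apply: (@sdiff_series _ _ (fun n v => 2^-1 ^+ n.+1 * s n v) S v 3 1) => //.
  - move=> n y z _ _; rewrite -mulrBr normrM ger0_norm ?half_pow_ge0// exprS.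
    have h0 := half_pow_ge0 (R := R) n.
    have : 2^-1 ^+ n * `|s n y - s n z| <= 2^-1 ^+ n * (6 * `|y - z|).
      by rewrite ler_wpM2l// smooth_abs_lip.
    by lra.
  - by move=> n; apply: sdZ; exact: sd_smooth_abs.
have Spos v : 0 <= S v.
  by apply: le_trans (Sge 0%N v); rewrite mulr_ge0 ?half_pow_ge0// smooth_abs_ge0.
exists S; split=> //.
  have [L SL] := Sd 0; have L0 : L = fun _ => 0.
    by apply/funext; apply: (sdiff_min SL) => y; rewrite S0.
  by rewrite -L0.
exists (d 0%N) => // v vd.
have [->|v0] := eqVneq v 0.
  have [_ /(_ 0)] := dP 0%N; rewrite normr0 mulr0 S0 => h; exact: h.
have nv : 0 < `|v| by rewrite normr_gt0.
(* Such an [n] exists because d n <= 2^-n; the least one determines the shell containing [v]. *)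
have exn : exists n, d n <= `|v|.
  have [n nP] := exists_half_pow 1 nv; exists n; rewrite mul1r in nP.
  by have [/andP[_ dn] _] := dP n; exact: le_trans dn nP.
case: (ex_minnP exn) => -[|n] nv1 nmin; first by move: vd; rewrite ltNge nv1.
have vn : `|v| < d n by rewrite ltNge; apply/negP => /nmin; rewrite ltnn.
have [_ /(_ _ vn)] := dP n; apply: Qmono.
apply: le_trans (Sge n v); rewrite exprS.
have h0 := half_pow_ge0 (R := R) n.
have : 2^-1 ^+ n * (2 * `|v|) <= 2^-1 ^+ n * s n v.
  by rewrite ler_wpM2l// smooth_abs_ge.
by lra.
Qed.

End HilbertSpace.

(** * Subdifferentials and superdifferentials *)

Section Subdifferentials.
Context {R : realType} {H : hilbertType R} {M : manifold H}.
Variable g : riemannian_metric M.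
Implicit Types (f : M -> \bar R) (p x : M) (phi : M -> R).

Lemma sdiff_ext (V W : normedModType R) (u u' : V -> W) (x : V) L L' :
  u =1 u' -> L =1 L' -> sdiff u x L -> sdiff u' x L'.
Proof. by move=> /funext -> /funext ->. Qed.

Lemma dchart_inv_linear p (h : chart_at p) : linear (dchart_inv h).
Proof.
move=> a u v; apply: val_inj; apply: funext => k /=.
by rewrite [LHS]linearP.
Qed.

Lemma blin_cotangent_coord p (eta : cotangent p) (h : chart_at p) :
  blin (cotangent_coord eta h : H -> R).
Proof.
have mem : (cotangent_coord eta h : H -> R^o) \in @clin_pred _ H R^o.
  rewrite inE; split; last exact: cotangent_continuous.
  by move=> a u v; rewrite /cotangent_coord dchart_inv_linear linearP.
exact: (clin_blin (CLin mem)).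
Qed.

(** Clearing the denominator settles infinite values of [f] as well: +oo satisfies both sides, and
    -oo makes the quotient -oo. The excluded vector [v = 0] gives an equality. *)
Lemma liminf_quotientP f p (a : R) (eta : cotangent p) (h : chart_at p) :
  f p = a%:E ->
  (0 <= limf_einf (chart_quotient f eta h) (0%R : H)^')%E <->
  forall e, 0 < e -> exists2 d, 0 < d & forall v, `|v| < d ->
    ((a + cotangent_coord eta h v - e * `|v|)%:E <= f (chart_inv h (h p + v)%R))%E.
Proof.
move=> fpa; have [zl _] := blin_cotangent_coord eta h; split.
- rewrite limf_einfE => h0 e e0.
  have : ((- e)%:E < ereal_sup [set ereal_inf (chart_quotient f eta h @` V) |
      V in (0%R : H)^'])%E by apply: lt_le_trans h0; rewrite lte_fin oppr_lt0.
  move=> /ereal_sup_gt[_ [V V0 <-]] Ve.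
  move: V0; rewrite /dnbhs /within /= => /nbhs_ballP[d /= d0 dV].
  exists d => // v vd; have [->|v0] := eqVneq v 0.
    by rewrite (lin0 zl) normr0 mulr0 addr0 subr0 addr0 chart_atK fpa.
  have vV : V v by apply: dV => //; rewrite -ball_normE /= sub0r normrN.
  have : ((- e)%:E <= chart_quotient f eta h v)%E.
    by apply: le_trans (ltW Ve) _; apply: ereal_inf_lbound; exists v.
  have nv : 0 < `|v| by rewrite normr_gt0.
  rewrite /chart_quotient fpa; case: (f _) => [b| |].
  + rewrite -!EFinB -EFinM !lee_fin ler_pdivlMr//; lra.
  + by rewrite leey.
  + rewrite !addNye gt0_mulNye ?lte_fin ?invr_gt0//.
- move=> he; apply/lee_addgt0Pr => e e0; rewrite -leeBlDr//.
  rewrite limf_einfE; have [d d0 dP] := he e e0.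
  pose V := [set v : H | v != 0 /\ `|v| < d].
  apply: (@le_trans _ _ (ereal_inf (chart_quotient f eta h @` V))); last first.
    apply: ereal_sup_ubound; exists V => //.
    rewrite /dnbhs /within /=; apply/nbhs_ballP; exists d => //= v.
    by rewrite -ball_normE /= sub0r normrN => vd v0; split.
  apply: le_ereal_inf_tmp => _ [v [v0 vd] <-].
  have nv : 0 < `|v| by rewrite normr_gt0.
  have := dP v vd; rewrite /chart_quotient fpa; case: (f _) => [b| |].
  + rewrite -!EFinB -EFinM !lee_fin ler_pdivlMr//; lra.
  + by move=> _; rewrite !addye// gt0_mulye ?lte_fin ?invr_gt0// leey.
  + by rewrite leeNy_eq.
Qed.

Lemma sub_le_subE f p x phi (a : R) : f p = a%:E ->
  (f p - (phi p)%:E <= f x - (phi x)%:E)%E = ((a - phi p + phi x)%:E <= f x)%E.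
Proof.
move=> ->; case: (f x) => [b| |].
- by rewrite -!EFinB !lee_fin; apply/idP/idP; lra.
- by rewrite addye// !leey.
- by rewrite addNye -EFinB !leeNy_eq.
Qed.

Lemma mdiff_near phi psi p : msd phi p -> msd psi p -> forall b : R,
  (\forall x \near p, psi x = phi x + b) ->
  mdiff psi (p := p) = mdiff phi (p := p) :> (tangent p -> R).
Proof.
move=> phid psid b pp; set k := some_chart p; have [L kL] := phid k.
have nk : \forall y \near k p, (phi \o chart_inv k) y + b = (psi \o chart_inv k) y.
  have n1 : \forall y \near k p, psi (chart_inv k y) = phi (chart_inv k y) + b.
    exact: (@chart_inv_cvg _ _ _ _ k _ pp).
  by apply: filterS n1 => y /= ->.
have kL' := sdiff_near nk (sdiffD kL (sdiff_cst b (k p))).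
apply/funext => v; rewrite /mdiff -/k.
have [_ d1] := sdiff_diff (W := R^o) kL; have [_ d2] := sdiff_diff (W := R^o) kL'.
by rewrite d1 d2 /= addr0.
Qed.

Lemma mdiff_chart phi p (h : chart_at p) (eta : cotangent p) : C1 phi ->
  sdiff (phi \o chart_inv h) (h p) (cotangent_coord eta h) ->
  eta = mdiff phi (p := p) :> (tangent p -> R).
Proof.
move=> phi1 hL; apply/funext => v; rewrite (mdiffE h); last exact: C1_differentiable.
have [_ ->] := sdiff_diff (W := R^o) hL.
by rewrite /cotangent_coord dchartK.
Qed.

Lemma liminf_subdifferential f p (a : R) (eta : cotangent p) (h : chart_at p) :
  f p = a%:E -> (0 <= limf_einf (chart_quotient f eta h) (0%R : H)^')%E ->
  subdifferential f eta.
Proof.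
move=> fpa /(liminf_quotientP _ _ fpa) fe.
have bz := blin_cotangent_coord eta h; set zeta := cotangent_coord eta h in fe bz.
pose Q v t := ((a + zeta v - t)%:E <= f (chart_inv h (h p + v)%R))%E.
have Qmono v s t : s <= t -> Q v s -> Q v t.
  by move=> st; apply: le_trans; rewrite lee_fin lerD2l lerN2.
have [theta [theta0 theta00 thetad [d0 d00 thetaQ]]] := exists_C1_remainder Qmono fe.
have [rho [c [C hb]]] := metric_bounds g h; have [rho0 _ _ _ _] := hb.
(* The cutoff is 1 up to radius [r] and 0 beyond [2 * r], which must stay below [rho] for the
   extension by zero. *)
pose r := rho / 4; have r0 : 0 < r by rewrite divr_gt0.
have rrho : 2 * r < rho by rewrite /r; lra.
pose w0 y := zeta (y - h p) - theta (y - h p).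
pose w y := cutoff (h p) r y * w0 y.
have shift_blin y : sdiff (fun y => y - h p : H) y id.
  have bid : blin (@id H) by split=> //; exists 1 => // v; rewrite mul1r.
  have := sdiffD (sdiff_blin y bid) (sdiff_cst (- h p) y).
  by rewrite (_ : (fun v => v + 0) = id)//; apply/funext => v; rewrite addr0.
have w0d y : sd w0 y.
  apply: sdB; first by eexists; exact: sdiff_comp (shift_blin y) (sdiff_blin _ bz).
  by have [L tL] := thetad (y - h p); eexists; exact: sdiff_comp (shift_blin y) tL.
have wd y : sd w y by apply: sdM => //; exact: sd_cutoff.
have w_out y : 2 * r < `|y - h p| -> w y = 0.
  by move=> yr; rewrite /w cutoff0// mul0r.
pose phi x := a + ext h rho w x.
have phid x : msd phi x.
  by apply: msdD; [exact: msd_cst|exact: (ext_msd hb rrho w_out wd)].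
have phi1 : C1 phi by apply/C1_msd.
have phiE x : chart_ball h r x -> phi x = a + w0 (h x).
  move=> [hx xr]; rewrite /phi ext_in.
    by rewrite /w cutoff1 ?mul1r// ltW.
  by split=> //; apply: lt_trans xr _; move: rrho; lra.
have pr : chart_ball h r p by split; [exact: chart_at_dom|rewrite subrr normr0].
have phip : phi p = a.
  by rewrite phiE// /w0 subrr (lin0 bz.1) theta0 subrr addr0.
exists phi; split=> //.
  have pd : chart_ball h (Num.min r d0) p.
    by split; [exact: chart_at_dom|rewrite subrr normr0 lt_min r0].
  apply: filterS (near_chart_ball pd) => x [hx]; rewrite lt_min => /andP[xr xd].
  rewrite (sub_le_subE _ _ fpa) phip subrr add0r phiE//.
  have := thetaQ _ xd; rewrite /Q [h p + _]addrC subrK chart_domK//.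
  by rewrite /w0 addrA.
apply: (mdiff_chart phi1).
have near_eq : \forall y \near h p, a + w0 y = (phi \o chart_inv h) y.
  have n1 : \forall y \near h p, chart_ball h r (chart_inv h y).
    exact: (@chart_inv_cvg _ _ _ _ h _ (near_chart_ball pr)).
  apply: filterS2 n1 (near_chart_img h) => y yr yi.
  by rewrite /= phiE//; have [_ ->] := chart_imgP yi.
apply: sdiff_near near_eq _.
have s1 := sdiff_comp (shift_blin (h p)) (sdiff_blin _ bz).
have tp : sdiff theta (h p - h p) (fun _ => 0) by rewrite subrr.
have s2 := sdiff_comp (shift_blin (h p)) tp.
have s3 := sdiffM (sdiff_cst (-1 : R) (h p)) s2.
apply: sdiff_ext (sdiffD (sdiff_cst a (h p)) (sdiffD s1 s3)) => [y|v] /=.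
  by rewrite mulN1r.
by rewrite !mulr0 !addr0 add0r.
Qed.

Lemma frechet_liminf f p (a : R) (eta : cotangent p) phi : f p = a%:E ->
  local_min_at (fun x => f x - (phi x)%:E)%E p -> frechet_differentiable phi p ->
  eta = mdiff phi (p := p) :> (tangent p -> R) ->
  forall h : chart_at p, (0 <= limf_einf (chart_quotient f eta h) (0%R : H)^')%E.
Proof.
move=> fpa fmin phid etaE h; apply/(liminf_quotientP _ _ fpa) => e e0.
have zE v : cotangent_coord eta h v = 'd (phi \o chart_inv h : H -> R^o) (h p) v.
  by rewrite /cotangent_coord etaE (mdiffE h)// dchart_invK.
have n1 := differentiable_slope (phid h) e0.
have n2 : \forall y \near h p,
    (f p - (phi p)%:E <= f (chart_inv h y) - (phi (chart_inv h y))%:E)%E.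
  exact: (@chart_inv_cvg _ _ _ _ h _ fmin).
move/nbhs_ballP: n1 => [d1 /= d10 dP1]; move/nbhs_ballP: n2 => [d2 /= d20 dP2].
exists (Num.min d1 d2) => [|v]; first by rewrite lt_min d10.
rewrite lt_min => /andP[v1 v2].
have vB d : `|v| < d -> ball (h p) d (h p + v).
  by rewrite -ball_normE /= opprD addNKr normrN.
have h1 := dP1 _ (vB _ v1); have h2 := dP2 _ (vB _ v2); rewrite /= in h1 h2.
rewrite (sub_le_subE _ _ fpa) in h2.
apply: le_trans h2; rewrite lee_fin zE.
rewrite [h p + v - h p]addrAC subrr add0r chart_atK in h1.
by move: h1; rewrite ler_norml => /andP[h1 _]; lra.
Qed.

(** The function [Phi] is the combination (1 - B) psi + B phi0 of two minorants: [psi] is valid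
    everywhere, and [phi0], which is [phi] shifted to take the value [f p] at [p], is valid where
    [B] is nonzero. Near [p], where [B] is 1, only [phi0] remains. *)
Lemma subdifferential_global f p (a : R) (eta : cotangent p) : f p = a%:E ->
  locally_bounded_below f -> subdifferential f eta ->
  exists phi : M -> R, [/\ C1 phi, global_min_at (fun x => f x - (phi x)%:E)%E p &
    eta = mdiff phi (p := p) :> (tangent p -> R)].
Proof.
move=> fpa fb [phi [/C1_msd phid fmin ->]].
have [psi /C1_msd psid psif] := exists_C1_minorant g fb.
pose h := some_chart p; have [r0 r00 hr0] := chart_ball_basis h fmin.
have [rho [c [C hb]]] := metric_bounds g h; have [rho0 _ _ _ _] := hb.
pose r := Num.min r0 rho / 4.
have m0 : 0 < Num.min r0 rho by rewrite lt_min r00.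
have m1 : Num.min r0 rho <= r0 by rewrite ge_min lexx.
have m2 : Num.min r0 rho <= rho by rewrite ge_min lexx orbT.
have r_gt0 : 0 < r by rewrite divr_gt0.
have rrho : 2 * r < rho by rewrite /r; lra.
have rr0 : 2 * r < r0 by rewrite /r; lra.
pose B := ext h rho (cutoff (h p) r).
have w_out y : 2 * r < `|y - h p| -> cutoff (h p) r y = 0 by exact: cutoff0.
have Bd x : msd B x by exact: (ext_msd hb rrho w_out (fun y => sd_cutoff _ _ y)).
have B01 x : 0 <= B x <= 1.
  by rewrite /B /ext; case: asboolP => _; rewrite ?cutoff01// lexx ler01.
pose phi0 x := phi x + (a - phi p).
have phi0d x : msd phi0 x by apply: msdD => //; exact: msd_cst.
pose Phi x := psi x + B x * (phi0 x - psi x).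
have Phid x : msd Phi x.
  by apply: msdD => //; apply: msdM => //; exact: msdB.
have B1 x : chart_ball h r x -> B x = 1.
  move=> [hx xr]; rewrite /B ext_in; first by rewrite cutoff1// ltW.
  by split=> //; apply: lt_trans xr _; lra.
have pr : chart_ball h r p by split; [exact: chart_at_dom|rewrite subrr normr0].
have Phip : Phi p = a by rewrite /Phi B1// /phi0; ring.
exists Phi; split; first by apply/C1_msd.
- move=> x; rewrite (sub_le_subE _ _ fpa) Phip subrr add0r.
  have [Bx0|Bx0] := eqVneq (B x) 0.
    by rewrite /Phi Bx0 mul0r addr0.
  have [[hx _] cx] := ext_neq0 Bx0.
  have xr : `|h x - h p| <= 2 * r.
    by rewrite leNgt; apply/negP => /(cutoff0 r_gt0) cx0; rewrite cx0 eqxx in cx.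
  have := hr0 x (conj hx (le_lt_trans xr rr0)); rewrite (sub_le_subE _ _ fpa).
  have := psif x; have /andP[b0 b1] := B01 x.
  case: (f x) => [b| |]; rewrite ?leey ?leeNy_eq// !lee_fin /Phi /phi0 => h1 h2.
  have h3 : B x * (phi x + (a - phi p)) <= B x * b by rewrite ler_wpM2l//; lra.
  have h4 : (1 - B x) * psi x <= (1 - B x) * b by rewrite ler_wpM2l// subr_ge0.
  by lra.
- apply/esym; apply: (mdiff_near (phid p) (Phid p) (b := a - phi p)).
  apply: filterS (near_chart_ball pr) => x xr.
  by rewrite /Phi B1// mul1r addrC subrK.
Qed.

Lemma subdifferential_equivalence f p (eta : cotangent p) : f p \is a fin_num ->
  [<-> subdifferential f eta;
       exists phi : M -> R,
         [/\ local_min_at (fun x => f x - (phi x)%:E)%E p,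
             frechet_differentiable phi p &
             eta = mdiff phi (p := p) :> (tangent p -> R)];
       forall h : chart_at p,
         (0 <= limf_einf (chart_quotient f eta h) (0%R : H)^')%E;
       exists h : chart_at p,
         (0 <= limf_einf (chart_quotient f eta h) (0%R : H)^')%E] /\
  (locally_bounded_below f ->
     (subdifferential f eta <->
      exists phi : M -> R,
        [/\ C1 phi, global_min_at (fun x => f x - (phi x)%:E)%E p &
            eta = mdiff phi (p := p) :> (tangent p -> R)])).
Proof.
move=> /fineK/esym fpa; split; last first.
  move=> fb; split=> [|[phi [phi1 fmin etaE]]].
    exact: subdifferential_global fpa fb.
  by exists phi; split=> //; apply: nearW.
tfae.
- move=> [phi [phi1 fmin etaE]]; exists phi; split=> //; exact: C1_differentiable.
- move=> [phi [fmin phid etaE]]; exact: frechet_liminf fpa fmin phid etaE.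
- by move=> fh; exists (some_chart p).
- by move=> [h fh]; exact: liminf_subdifferential fpa fh.
Qed.

End Subdifferentials.

(** * Superdifferentials by change of sign *)

Section Negation.
Context {R : realType} {H : hilbertType R} {M : manifold H}.
Implicit Types (f : M -> \bar R) (p x : M) (phi : M -> R).

Section Cotangent.
Context {p : M}.
Variable eta : cotangent p.

Definition opp_cotangent_fun (v : tangent p) : R^o := - eta v.

Lemma opp_cotangent_linear : linear opp_cotangent_fun.
Proof. by move=> a u v; rewrite /opp_cotangent_fun linearP opprD scalerN. Qed.

HB.instance Definition _ :=
  GRing.isLinear.Build R (tangent p) R^o *:%R opp_cotangent_fun opp_cotangent_linear.

Lemma opp_cotangent_continuous (h : chart_at p) :
  continuous (opp_cotangent_fun \o dchart_inv h : H -> R^o).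
Proof. by move=> v; apply: cvgN; exact: cotangent_continuous. Qed.

Definition opp_cotangent : cotangent p :=
  @Cotangent _ _ _ _ opp_cotangent_fun opp_cotangent_continuous.

End Cotangent.

Lemma frechet_differentiableN phi p : frechet_differentiable phi p ->
  frechet_differentiable (fun x => - phi x) p.
Proof. by move=> phid h; apply: (differentiableN (phid h)). Qed.

Lemma mdiffN phi p (v : tangent p) : frechet_differentiable phi p ->
  mdiff (fun x => - phi x) v = - mdiff phi v.
Proof. by move=> phid; rewrite /mdiff (diffN (phid (some_chart p))). Qed.

Lemma C1N phi : C1 phi -> C1 (fun x => - phi x).
Proof.
move=> /C1_msd phid; apply/C1_msd => x.
rewrite (_ : (fun x => - phi x) = fun x => 0 - phi x); last by apply/funext => y; rewrite sub0r.
by apply: msdB => //; exact: msd_cst.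
Qed.

Lemma lee_sub_opp (u w : \bar R) (b c : R) :
  (u - b%:E <= w - c%:E)%E = (- w - (- c)%:E <= - u - (- b)%:E)%E.
Proof. by rewrite -leeN2 !fin_num_oppeB// !EFinN !oppeK. Qed.

Lemma lee_sub_opp' (u w : \bar R) (b c : R) :
  (- w - b%:E <= - u - c%:E)%E = (u - (- c)%:E <= w - (- b)%:E)%E.
Proof. by rewrite lee_sub_opp !oppeK. Qed.

Lemma opp_cotangent_mdiff p (eta : cotangent p) phi : frechet_differentiable phi p ->
  eta = mdiff phi (p := p) :> (tangent p -> R) ->
  opp_cotangent eta = mdiff (fun x => - phi x) (p := p) :> (tangent p -> R).
Proof. by move=> phid etaE; apply/funext => v; rewrite mdiffN// -etaE. Qed.

Lemma opp_cotangent_mdiff' p (eta : cotangent p) phi : frechet_differentiable phi p ->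
  opp_cotangent eta = mdiff phi (p := p) :> (tangent p -> R) ->
  eta = mdiff (fun x => - phi x) (p := p) :> (tangent p -> R).
Proof.
by move=> phid etaE; apply/funext => v; rewrite mdiffN// -etaE [RHS]opprK.
Qed.

Lemma superdifferential_opp f p (eta : cotangent p) :
  superdifferential f eta <-> subdifferential (fun x => - f x)%E (opp_cotangent eta).
Proof.
split=> -[phi [phi1 fext etaE]]; exists (fun x => - phi x); split.
- exact: C1N.
- by apply: filterS fext => x; rewrite lee_sub_opp.
- by apply: opp_cotangent_mdiff => //; exact: C1_differentiable.
- exact: C1N.
- by apply: filterS fext => x; rewrite lee_sub_opp'.
- by apply: opp_cotangent_mdiff' => //; exact: C1_differentiable.
Qed.

Lemma exists_frechet_max_opp f p (eta : cotangent p) :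
  (exists phi : M -> R, [/\ local_max_at (fun x => f x - (phi x)%:E)%E p,
     frechet_differentiable phi p & eta = mdiff phi (p := p) :> (tangent p -> R)]) <->
  (exists phi : M -> R, [/\ local_min_at (fun x => - f x - (phi x)%:E)%E p,
     frechet_differentiable phi p &
     opp_cotangent eta = mdiff phi (p := p) :> (tangent p -> R)]).
Proof.
split=> -[phi [fext phid etaE]]; exists (fun x => - phi x); split.
- by apply: filterS fext => x; rewrite lee_sub_opp.
- exact: frechet_differentiableN.
- exact: opp_cotangent_mdiff.
- by apply: filterS fext => x; rewrite lee_sub_opp'.
- exact: frechet_differentiableN.
- exact: opp_cotangent_mdiff'.
Qed.

Lemma exists_C1_global_max_opp f p (eta : cotangent p) :
  (exists phi : M -> R, [/\ C1 phi, global_max_at (fun x => f x - (phi x)%:E)%E p &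
     eta = mdiff phi (p := p) :> (tangent p -> R)]) <->
  (exists phi : M -> R, [/\ C1 phi, global_min_at (fun x => - f x - (phi x)%:E)%E p &
     opp_cotangent eta = mdiff phi (p := p) :> (tangent p -> R)]).
Proof.
split=> -[phi [phi1 fext etaE]]; exists (fun x => - phi x); split.
- exact: C1N.
- by move=> x; have := fext x; rewrite lee_sub_opp.
- by apply: opp_cotangent_mdiff => //; exact: C1_differentiable.
- exact: C1N.
- by move=> x; have := fext x; rewrite lee_sub_opp'.
- by apply: opp_cotangent_mdiff' => //; exact: C1_differentiable.
Qed.

Lemma limsup_quotient_opp f p (eta : cotangent p) (h : chart_at p) : f p \is a fin_num ->
  (limf_esup (chart_quotient f eta h) (0%R : H)^' <= 0)%E =
  (0 <= limf_einf (chart_quotient (fun x => - f x) (opp_cotangent eta) h) (0%R : H)^')%E.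
Proof.
move=> fp; rewrite (_ : chart_quotient (fun x => - f x)%E _ h =
    (\- chart_quotient f eta h)%E); first by rewrite limf_einfN oppe_ge0.
apply/funext => v; rewrite /chart_quotient /cotangent_coord /= /opp_cotangent_fun.
rewrite -mulNe; congr (_ * _)%E.
by rewrite !fin_num_oppeD ?fin_numN.
Qed.

End Negation.

Local Open Scope ereal_scope.

Theorem theorem4p3 (R : realType) (H : hilbertType R) (M : manifold H)
  (g : riemannian_metric M)
  (f : M -> \bar R) (f_ninfty : forall x, f x != -oo)
  (p : M) (fp_lty : f p < +oo) (eta : cotangent p) :
  ([<-> subdifferential f eta;
        exists phi : M -> R,
          [/\ local_min_at (fun x => f x - (phi x)%:E) p,
              frechet_differentiable phi p &
              eta = mdiff phi (p := p) :> (tangent p -> R)];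
        forall h : chart_at p,
          0 <= limf_einf (chart_quotient f eta h) (0%R : H)^';
        exists h : chart_at p,
          0 <= limf_einf (chart_quotient f eta h) (0%R : H)^'] /\
   (locally_bounded_below f ->
     (subdifferential f eta <->
      exists phi : M -> R,
        [/\ C1 phi, global_min_at (fun x => f x - (phi x)%:E) p &
            eta = mdiff phi (p := p) :> (tangent p -> R)]))) /\
  ([<-> superdifferential f eta;
        exists phi : M -> R,
          [/\ local_max_at (fun x => f x - (phi x)%:E) p,
              frechet_differentiable phi p &
              eta = mdiff phi (p := p) :> (tangent p -> R)];
        forall h : chart_at p,
          limf_esup (chart_quotient f eta h) (0%R : H)^' <= 0;
        exists h : chart_at p,
          limf_esup (chart_quotient f eta h) (0%R : H)^' <= 0] /\
   (locally_bounded_above f ->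
     (superdifferential f eta <->
      exists phi : M -> R,
        [/\ C1 phi, global_max_at (fun x => f x - (phi x)%:E) p &
            eta = mdiff phi (p := p) :> (tangent p -> R)]))).
Proof.
have fp : f p \is a fin_num by rewrite fin_numE f_ninfty lt_eqF.
split; first exact: subdifferential_equivalence.
have fpN : - f p \is a fin_num by rewrite fin_numN.
have [sub subg] := @subdifferential_equivalence _ _ _ g (fun x => - f x) p (opp_cotangent eta) fpN.
split; last first.
  move=> fb; rewrite superdifferential_opp exists_C1_global_max_opp; apply: subg => x.
  have [c fc] := fb x; exists (- c)%R.
  by apply: filterS fc => y; rewrite EFinN leeN2.
tfae.
- by move=> /superdifferential_opp /(sub 0 1)%N /exists_frechet_max_opp.
- move=> /exists_frechet_max_opp /(sub 1 2)%N fh h.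
  by rewrite limsup_quotient_opp.
- by move=> fh; exists (some_chart p).
- move=> [h]; rewrite limsup_quotient_opp// => fh.
  by apply/superdifferential_opp/(sub 3 0)%N; exists h.
Qed.
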